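(* For $\alpha\in(0,2)$, $r\in(0,\infty)$, and $k\in K_\alpha$, the function $M_{k,r}:=m_{k,r,\frac{\alpha-1}{2}}$ is a critical $(k,2)$-Hardy weight.
   Context: All functions are Borel measurable; $\mathbb{R}_*:=\mathbb{R}\setminus\{0\}$. For $\alpha\in(0,2)$, $K_\alpha$ is the set of all functions $k:\mathbb{R}^2\to[0,\infty]$ such that $k(x,y)=k(y,x)$ for all $x,y\in\mathbb{R}$; $k(tx,ty)=t^{-\alpha-1}k(x,y)$ for all $x,y\in\mathbb{R}$, $t>0$; and there is a constant $c\in(0,\infty)$ with $k(x,y)\le c|x-y|^{-\alpha-1}$ for all $x,y$. A function $w:\mathbb{R}\to\mathbb{R}$, locally integrable on $\mathbb{R}_*$, is a $(k,2)$-Hardy weight if $\frac12\int_{\mathbb{R}}\int_{\mathbb{R}}(u(x)-u(y))^2k(x,y)\,dx\,dy\ge\int_{\mathbb{R}}u(x)^2w(x)\,dx$ for all $u\in C_c(\mathbb{R}_* )$. It is critical if moreover it cannot be increased in this inequality on any set of positive Lebesgue measure; i.e. whenever $W\ge w$ a.e. and $W$ is a $(k,2)$-Hardy weight, then $W=w$ a.e. (Weights need only be defined for $x\neq0$.) For $\rho\in(-1,\alpha)$ define $$\gamma_+(k,\rho):=\int_0^1(1-t^\rho)(1-t^{\alpha-1-\rho})k(1,t)\,dt,\qquad \gamma_-(k,\rho):=\int_0^1(1-t^\rho)(1-t^{\alpha-1-\rho})k(-1,-t)\,dt,$$ $$C_+(k,r,\rho):=\gamma_+(k,\rho)+\int_0^\infty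 k(1,-t)\,dt-r\int_0^\infty t^\rho k(1,-t)\,dt,$$ $$C_-(k,r,\rho):=\gamma_-(k,\rho)+\int_0^\infty k(-1,t)\,dt-\frac1r\int_0^\infty t^\rho k(-1,t)\,dt ,$$ and $m_{k,r,\rho}(x):=|x|^{-\alpha}C_+(k,r,\rho)$ for $x>0$, $m_{k,r,\rho}(x):=|x|^{-\alpha}C_-(k,r,\rho)$ for $x<0$. *)

(* Defs.v *)
From HB Require Import structures.
From mathcomp Require Import all_boot all_order all_algebra.
From mathcomp Require Import all_classical all_reals all_analysis measurable_realfun.

Set Implicit Arguments.
Unset Strict Implicit.
Unset Printing Implicit Defensive.

Import Order.TTheory GRing.Theory Num.Theory.
Import numFieldNormedType.Exports.

Local Open Scope classical_set_scope.
Local Open Scope ring_scope.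

Notation leb := (@lebesgue_measure _).

Definition Rstar (R : realType) : set R := [set x | x != 0].

(* On the diagonal the upper bound is c * |0|^(-alpha-1) = +oo, whereas
   [0 `^ p = 0] for p != 0; hence the restriction to x != y in the last clause. *)
Definition kernel_class (R : realType) (alpha : R) (k : R -> R -> \bar R) : Prop :=
  [/\ measurable_fun [set: R * R] (fun z : R * R => k z.1 z.2),
      (forall x y, 0 <= k x y)%E,
      (forall x y, k x y = k y x),
      (forall x y t, 0 < t ->
         k (t * x) (t * y) = ((t `^ (- alpha - 1))%:E * k x y)%E) &
      exists2 c : R, 0 < c &
        forall x y, x != y ->
          (k x y <= (c * `|x - y| `^ (- alpha - 1))%:E)%E].

(* C_c of the punctured line: each function is extended by 0 to the origin. *)
Definition Cc_Rstar (R : realType) (u : R -> R) : Prop :=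
  [/\ continuous u,
      compact (closure [set x | u x != 0]) &
      closure [set x | u x != 0] `<=` @Rstar R].

Definition energy (R : realType) (k : R -> R -> \bar R) (u : R -> R) : \bar R :=
  ((2^-1)%:E * \int[leb]_y \int[leb]_x (((u x - u y) ^+ 2)%:E * k x y))%E.

(* [locally_integrable] includes measurability on R_*; w 0 is irrelevant. *)
Definition hardy_weight (R : realType) (k : R -> R -> \bar R) (w : R -> R) : Prop :=
  locally_integrable (@Rstar R) w /\
  forall u : R -> R, Cc_Rstar u ->
    (\int[leb]_x ((u x) ^+ 2 * w x)%:E <= energy k u)%E.

Definition critical_hardy_weight (R : realType) (k : R -> R -> \bar R)
    (w : R -> R) : Prop :=
  hardy_weight k w /\
  forall W : R -> R, hardy_weight k W ->
    {ae leb, forall x, w x <= W x} -> {ae leb, forall x, W x = w x}.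

Definition gamma_plus (R : realType) (alpha : R) (k : R -> R -> \bar R) (rho : R) : \bar R :=
  (\int[leb]_(t in `]0%R, 1%R[)
     (((1 - t `^ rho) * (1 - t `^ (alpha - 1 - rho)))%:E * k 1%R t))%E.

Definition gamma_minus (R : realType) (alpha : R) (k : R -> R -> \bar R) (rho : R) : \bar R :=
  (\int[leb]_(t in `]0%R, 1%R[)
     (((1 - t `^ rho) * (1 - t `^ (alpha - 1 - rho)))%:E * k (-1)%R (- t)%R))%E.

Definition C_plus (R : realType) (alpha : R) (k : R -> R -> \bar R) (r rho : R) : \bar R :=
  (gamma_plus alpha k rho
   + \int[leb]_(t in `]0%R, +oo[) k 1%R (- t)%R
   - r%:E * \int[leb]_(t in `]0%R, +oo[) ((t `^ rho)%:E * k 1%R (- t)%R))%E.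

Definition C_minus (R : realType) (alpha : R) (k : R -> R -> \bar R) (r rho : R) : \bar R :=
  (gamma_minus alpha k rho
   + \int[leb]_(t in `]0%R, +oo[) k (-1)%R t
   - (r^-1)%:E * \int[leb]_(t in `]0%R, +oo[) ((t `^ rho)%:E * k (-1)%R t))%E.

(* The value at x = 0 is immaterial. *)
Definition m_weight (R : realType) (alpha : R) (k : R -> R -> \bar R) (r rho x : R) : \bar R :=
  ((`|x| `^ (- alpha))%:E *
   (if (0 < x)%R then C_plus alpha k r rho else C_minus alpha k r rho))%E.

Definition M_weight (R : realType) (alpha : R) (k : R -> R -> \bar R) (r : R) : R -> \bar R :=
  m_weight alpha k r ((alpha - 1) / 2).

(* Main.v *)
Require Import Defs.
From HB Require Import structures.
From mathcomp Require Import all_boot all_order all_algebra.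
From mathcomp Require Import all_classical all_reals all_analysis measurable_realfun.
From mathcomp Require Import ring lra.
Import Order.TTheory GRing.Theory Num.Theory.
Import numFieldNormedType.Exports.
Local Open Scope classical_set_scope.
Local Open Scope ring_scope.

Set Implicit Arguments.
Unset Strict Implicit.
Unset Printing Implicit Defensive.

(* With rho = (alpha - 1) / 2, the ground state is h(x) = x^rho for x > 0 and
   h(x) = r |x|^rho for x < 0, and the energy splits as
     energy(u) = int u^2 M + (1/2) iint (u(x)/h(x) - u(y)/h(y))^2 h(x) h(y) k(x,y).
   No principal value is needed: for x, y of the same sign, put y = t x with
   0 < t < 1; homogeneity turns the double integral into
   int k(1,t) J(t) dt with J(t) = int x^-alpha (u(x) - u(tx))^2 dx, and for each
   fixed t the ground state identity for J(t) involves only finite integrals.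
   For opposite signs k is not singular and the identity is integrated directly.
   This gives the Hardy inequality.  For criticality, truncate h logarithmically:
   u_n = h max(0, 1 - |ln|x||/(n+1)).  Since ln is a Haar coordinate for dx/x, the
   remainder of u_n is O(1/n), so int u_n^2 (W - M) -> 0 for any larger weight W. *)

(** The value rho = (alpha - 1) / 2 is the fixed point of rho -> alpha - 1 - rho. It makes (1 -
    t^rho)(1 - t^(alpha-1-rho)) a square, so every same-sign term is nonnegative, and it makes
    x^(-alpha) h(x)^2 a constant multiple of 1/|x| on each half-line, so that logarithmic cutoffs
    see a dilation invariant measure. The rate 1/n arises from a difference of size |ln t| / (n+1),
    squared, on a set of logarithmic length of order n+1.

    The energy and the remainder lie in [0, +oo] and may both be infinite, so nothing can be
    subtracted freely. Each identity is therefore proved between sums of nonnegative terms, and only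
    real terms are cancelled. This calls for finiteness of gamma, of the opposite-sign integrals and
    of their analogues with ln^2 t. At t = 1 the kernel is at most as singular as (1-t)^(-alpha-1),
    and the quadratic vanishing of (1-t^rho)^2 or ln^2 t leaves the exponent 1 - alpha > -1; for
    opposite signs the bound is c (1+t)^(-alpha-1), and rho lies in (-1, alpha). *)

Definition Rpos {R : realType} : set R := `]0, +oo[%classic.

(** * Integrals over the half-line *)

Section half_line.
Context {R : realType}.
Notation mu := (@lebesgue_measure R).
Local Open Scope ereal_scope.
Notation Rpos := (@Rpos R).

Lemma RposE x : Rpos x = (0 < x)%R.
Proof. by rewrite /Rpos /= in_itv/= andbT. Qed.

Lemma measurable_Rpos : measurable Rpos.
Proof. exact: measurable_itv. Qed.
Hint Resolve measurable_Rpos : core.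

Lemma measurable_mull (a : R) : measurable_fun setT ( *%R a).
Proof. by apply: measurable_funM => //; exact: measurable_id. Qed.

(** Uniqueness of Lebesgue measure: the pushforward under x -> a x, scaled by a, gives half-open
    intervals their length. *)
Lemma lebesgue_measure_dilation (a : R) (A : set R) : (0 < a)%R -> measurable A ->
  mu A = a%:E * mu ( *%R a @^-1` A).
Proof.
move=> a0 mA.
have ma : measurable_fun [set: measurableTypeR R]
   ( *%R a : measurableTypeR R -> measurableTypeR R) by exact: measurable_mull.
pose m' : {measure set (measurableTypeR R) -> \bar R} :=
  mscale (NngNum (ltW a0))
    (measure_function_pushforward__canonical__measure_function_Measure mu ma).
have mE B : m' B = a%:E * mu ( *%R a @^-1` B) by [].
rewrite -mE; apply: lebesgue_measure_unique mA => _ [[b c]] _ <-; rewrite mE.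
rewrite (_ : _ @^-1` _ = `](b / a)%R, (c / a)%R]%classic); last first.
  by apply/seteqP; split => x /=; rewrite !in_itv/= ltr_pdivrMr// ler_pdivlMr// (mulrC x).
rewrite !lebesgue_measure_itv/= !lte_fin ltr_pM2r ?invr_gt0//.
case: ifPn => _; last by rewrite mule0.
by rewrite -EFinM; congr EFin; field; rewrite gt_eqF.
Qed.

Lemma integral_Rpos_dilation (a : R) (f : R -> \bar R) : (0 < a)%R ->
  measurable_fun setT f -> (forall x, 0 <= f x) ->
  \int[mu]_(x in Rpos) f x = a%:E * \int[mu]_(x in Rpos) f (a * x)%R.
Proof.
move=> a0 mf f0.
have ma : measurable_fun [set: measurableTypeR R]
   ( *%R a : measurableTypeR R -> measurableTypeR R) by exact: measurable_mull.
pose pf := (measure_function_pushforward__canonical__measure_function_Measure mu ma).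
pose m' : {measure set (measurableTypeR R) -> \bar R} := mscale (NngNum (ltW a0)) pf.
transitivity (\int[m']_(x in Rpos) f x).
  by apply: eq_measure_integral => A mA _; exact: lebesgue_measure_dilation.
rewrite /m' ge0_integral_mscale//; last exact: measurable_funTS.
congr (_ * _).
rewrite (@ge0_integral_pushforward _ _ _ _ R _ ma mu Rpos f) => //.
- congr (integral _ _ _); apply/seteqP; split => x /=; rewrite !RposE => h.
    by rewrite -(pmulr_rgt0 _ a0).
  by rewrite mulr_gt0.
- exact: measurable_funTS.
Qed.

Lemma integral_Rpos_reflect (f : R -> \bar R) :
  measurable_fun setT f -> (forall x, 0 <= f x) ->
  \int[mu]_x f x = \int[mu]_(x in Rpos) f x + \int[mu]_(x in Rpos) f (- x)%R.
Proof.
move=> mf f0.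
have -> : \int[mu]_(x in Rpos) f (- x)%R = \int[mu]_(x in `]-oo, 0%R[) f x.
  have -> : Rpos = (-%R : measurableTypeR R -> measurableTypeR R) @^-1` `]-oo, 0%R[.
    by apply/seteqP; split => x /=; rewrite RposE in_itv/= oppr_lt0.
  rewrite -ge0_integral_pushforward//=; last exact: measurable_funTS.
  by apply: eq_measure_integral => //= A mA AS; exact: lebesgue_measureN.
(* Adding the null point 0 makes the two half-lines cover the line. *)
rewrite /Rpos (integral_itv_obnd_cbnd (r := 0%R)); last exact: measurable_funTS.
rewrite addeC -ge0_integral_setU//=.
- by congr (integral _ _ _); apply/seteqP; split => x //= _;
    rewrite !in_itv/= andbT; case: (ltP x 0%R); [left|right].
- exact: measurable_funTS.
- apply/disj_set2P; apply/seteqP; split => x //=; rewrite !in_itv/= andbT.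
  by move=> [x0 /(lt_le_trans x0)]; rewrite ltxx.
Qed.

(** Extending the integrand by 0 outside the quadrant reduces this to Tonelli on the plane. *)
Lemma tonelli_Rpos (f : R -> R -> \bar R) :
  measurable_fun setT (fun z : R * R => f z.1 z.2) -> (forall x y, 0 <= f x y) ->
  \int[mu]_(x in Rpos) \int[mu]_(y in Rpos) f x y =
  \int[mu]_(y in Rpos) \int[mu]_(x in Rpos) f x y.
Proof.
move=> mf f0.
pose g (z : R * R) := ((fun z => f z.1 z.2) \_ (Rpos `*` Rpos)) z.
have mg : measurable_fun setT g.
  apply/(measurable_restrictT _ (measurableX measurable_Rpos measurable_Rpos)).
  exact: measurable_funTS.
have g0 z : 0 <= g z by rewrite /g patchE; case: ifPn.
have := @fubini_tonelli _ _ _ _ _ mu mu g mg g0.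
have gE x y : g (x, y) = if (0 < x)%R && (0 < y)%R then f x y else 0.
  rewrite /g patchE/=; congr (if _ then _ else _).
  apply/idP/idP; rewrite inE /= !RposE; last by move=> /andP[].
  by move=> -[-> ->].
have E1 (b : R) (h : R -> \bar R) :
  \int[mu]_y (if (0 < b)%R && (0 < y)%R then h y else 0) =
  if (0 < b)%R then \int[mu]_(y in Rpos) h y else 0.
  case: ltP => _ /=; last by rewrite integral0_eq.
  rewrite [RHS]integral_mkcond; apply: eq_integral => x _; rewrite patchE.
  by congr (if _ then _ else _); apply/idP/idP; rewrite inE RposE.
have E2 (h : R -> \bar R) : \int[mu]_(y in Rpos) h y =
    \int[mu]_y if (0 < y)%R then h y else 0.
  rewrite integral_mkcond; apply: eq_integral => x _; rewrite patchE.
  by congr (if _ then _ else _); apply/idP/idP; rewrite inE RposE.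
under eq_integral do under eq_integral do rewrite gE.
under eq_integral do rewrite E1.
rewrite -E2 => ->.
under eq_integral do under eq_integral do rewrite gE andbC.
under eq_integral do rewrite E1.
by rewrite -E2.
Qed.

End half_line.

#[local] Hint Extern 0 (measurable _) => solve [exact: measurable_Rpos] : core.

Section half_line_measurability.
Context {R : realType}.
Notation mu := (@lebesgue_measure R).
Local Open Scope ereal_scope.
Notation Rpos := (@Rpos R).

Lemma measurable_fun_integral_Rpos (f : R -> R -> \bar R) :
  measurable_fun setT (fun z : R * R => f z.1 z.2) -> (forall x y, 0 <= f x y) ->
  measurable_fun setT (fun x => \int[mu]_(y in Rpos) f x y).
Proof.
move=> mf f0.
pose g (z : R * R) := if (0 < z.2)%R then f z.1 z.2 else 0.
have mg : measurable_fun setT g.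
  apply: measurable_fun_ifT => //.
  by apply: measurable_fun_ltr => //; exact: measurable_snd.
have g0 z : 0 <= g z by rewrite /g; case: ifPn.
have := @measurable_fun_fubini_tonelli_F _ _ _ _ _ mu g mg g0.
apply: eq_measurable_fun => x _; rewrite /fubini_F [RHS]integral_mkcond.
apply: eq_integral => y _; rewrite patchE /g /=.
by congr (if _ then _ else _); apply/idP/idP; rewrite inE RposE.
Qed.

Lemma eq_integral_Rpos (f g : R -> \bar R) : (forall x, (0 < x)%R -> f x = g x) ->
  \int[mu]_(x in Rpos) f x = \int[mu]_(x in Rpos) g x.
Proof. by move=> fg; apply: eq_integral => x; rewrite inE RposE; exact: fg. Qed.

Lemma measurable_fun_comp2 d (T : measurableType d) d' (T' : measurableType d')
    (F : R -> R -> T') (f g : T -> R) :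
  measurable_fun setT (fun z : R * R => F z.1 z.2) ->
  measurable_fun setT f -> measurable_fun setT g ->
  measurable_fun setT (fun z => F (f z) (g z)).
Proof. by move=> mF mf mg; exact: (measurableT_comp mF (measurable_fun_pair mf mg)). Qed.

Lemma integral_Rpos_if_lt1 (f : R -> \bar R) :
  \int[mu]_(t in Rpos) (if (t < 1)%R then f t else 0) = \int[mu]_(t in `]0%R, 1%R[) f t.
Proof.
rewrite integral_mkcond [RHS]integral_mkcond; apply: eq_integral => t _.
rewrite !patchE.
have -> : (t \in Rpos) = (0 < t)%R by apply/idP/idP; rewrite inE RposE.
have -> : (t \in `]0%R, 1%R[%classic) = (0 < t)%R && (t < 1)%R.
  by apply/idP/idP; rewrite inE /= in_itv.
by case: (0 < t)%R; case: (t < 1)%R.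
Qed.

(** For a = 1 the factor is 1: this is the invariance of dx/x on which the logarithmic cutoffs
    rely. *)
Lemma integral_Rpos_power_dilation (a t : R) (f : R -> \bar R) : (0 < t)%R ->
  measurable_fun setT f -> (forall x, 0 <= f x) ->
  \int[mu]_(x in Rpos) ((x `^ (- a))%:E * f (t * x)%R) =
  (t `^ (a - 1))%:E * \int[mu]_(x in Rpos) ((x `^ (- a))%:E * f x).
Proof.
move=> t0 mf f0.
have mx : measurable_fun setT (fun x : R => (x `^ (- a))%:E).
  by apply/measurable_EFinP; exact: measurable_powR.
rewrite (@integral_Rpos_dilation _ t (fun x => (x `^ (- a))%:E * f x))//; last 2 first.
- exact: emeasurable_funM.
- by move=> x; rewrite mule_ge0// lee_fin powR_ge0.
rewrite muleA -EFinM.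
have -> : (t `^ (a - 1) * t = t `^ a)%R.
  by rewrite mulrC -{1}(powRr1 (ltW t0)) -powRD ?(gt_eqF t0) ?implybT// addrC subrK.
rewrite -ge0_integralZl//; last 3 first.
- apply: measurable_funTS; apply: emeasurable_funM; last first.
    by apply: measurableT_comp => //; exact: measurable_mull.
  by apply/measurable_EFinP; apply: (measurableT_comp (measurable_powR _)); exact: measurable_mull.
- by move=> x _; rewrite mule_ge0// lee_fin powR_ge0.
- by rewrite lee_fin powR_ge0.
apply: eq_integral_Rpos => x x0.
rewrite muleA -EFinM powRM ?ltW// mulrA -powRD ?(gt_eqF t0) ?implybT//.
by rewrite subrr powRr0 mul1r.
Qed.

End half_line_measurability.

(** Symmetry and the upper bound are left out, so that transposes and the opposite-sign part of k,
    which need not be symmetric, also qualify. *)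
Definition homogeneous_kernel {R : realType} (alpha : R) (K : R -> R -> \bar R) : Prop :=
  [/\ measurable_fun [set: R * R] (fun z : R * R => K z.1 z.2),
      (forall x y, 0 <= K x y)%E &
      (forall x y t, 0 < t ->
         K (t * x) (t * y) = ((t `^ (- alpha - 1))%:E * K x y)%E)].

Section homogeneous_kernels.
Context {R : realType} (alpha : R).
Notation mu := (@lebesgue_measure R).
Local Open Scope ereal_scope.
Notation Rpos := (@Rpos R).
Implicit Type K : R -> R -> \bar R.

Lemma measurable_kernel_comp d (T : measurableType d) K (f g : T -> R) :
  homogeneous_kernel alpha K ->
  measurable_fun setT f -> measurable_fun setT g ->
  measurable_fun setT (fun z => K (f z) (g z)).
Proof.
by move=> [mK _ _]; exact: measurable_fun_comp2.
Qed.

(** Substitute y = t x: homogeneity gives K(x, t x) = x^(-alpha-1) K(1, t), the Jacobian is x, and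
    Tonelli exchanges x and t. *)
Lemma kernel_polar K (f : R -> R -> \bar R) : homogeneous_kernel alpha K ->
  measurable_fun setT (fun z : R * R => f z.1 z.2) -> (forall x y, 0 <= f x y) ->
  \int[mu]_(x in Rpos) \int[mu]_(y in Rpos) (f x y * K x y) =
  \int[mu]_(t in Rpos)
    (K 1%R t * \int[mu]_(x in Rpos) ((x `^ (- alpha))%:E * f x (t * x)%R)).
Proof.
move=> hK mf f0; have [_ K0 Khom] := hK.
pose G x t := (x `^ (- alpha))%:E * f x (t * x)%R.
have mG : measurable_fun setT (fun z : R * R => G z.1 z.2).
  apply: emeasurable_funM.
    by apply/measurable_EFinP; apply: (measurableT_comp (measurable_powR _)); exact: measurable_fst.
  apply: measurable_fun_comp2 mf _ _; first exact: measurable_fst.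
  by apply: measurable_funM; [exact: measurable_snd|exact: measurable_fst].
have G0 x t : 0 <= G x t by rewrite mule_ge0// lee_fin powR_ge0.
transitivity (\int[mu]_(x in Rpos) \int[mu]_(t in Rpos) (K 1%R t * G x t)).
  apply: eq_integral_Rpos => x x0.
  rewrite (@integral_Rpos_dilation _ x (fun y => f x y * K x y))//; last 2 first.
  - apply: emeasurable_funM; first by apply: measurable_fun_comp2 mf _ _;
      [exact: measurable_cst|exact: measurable_id].
    by apply: measurable_kernel_comp hK _ _; [exact: measurable_cst|exact: measurable_id].
  - by move=> y; rewrite mule_ge0.
  rewrite -ge0_integralZl//; last 3 first.
  - apply: measurable_funTS; apply: emeasurable_funM.
      by apply: measurable_fun_comp2 mf _ _; [exact: measurable_cst|exact: measurable_mull].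
    by apply: measurable_kernel_comp hK _ _; [exact: measurable_cst|exact: measurable_mull].
  - by move=> y _; rewrite mule_ge0.
  - by rewrite lee_fin ltW.
  apply: eq_integral_Rpos => t t0.
  have -> : K x (x * t)%R = (x `^ (- alpha - 1))%:E * K 1%R t by rewrite -Khom// mulr1.
  rewrite /G (mulrC t).
  have -> : (x `^ (- alpha) = x * x `^ (- alpha - 1))%R.
    by rewrite -{2}(powRr1 (ltW x0)) -powRD ?(gt_eqF x0) ?implybT// addrC subrK.
  rewrite EFinM (muleC (K _ _)) -!muleA; congr (_ * _).
  by rewrite muleCA.
rewrite tonelli_Rpos; last 2 first.
- apply: emeasurable_funM; last exact: mG.
  by apply: measurable_kernel_comp hK _ _; [exact: measurable_cst|exact: measurable_snd].
- by move=> x y; rewrite mule_ge0.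
apply: eq_integral_Rpos => t t0.
rewrite ge0_integralZl//.
apply: measurable_funTS.
by apply: measurable_fun_comp2 mG _ _; [exact: measurable_id|exact: measurable_cst].
Qed.

Definition transposed_kernel K : R -> R -> \bar R := fun x y => K y x.

Lemma homogeneous_transposed K : homogeneous_kernel alpha K ->
  homogeneous_kernel alpha (transposed_kernel K).
Proof.
move=> hK; have [_ K0 Khom] := hK; split => [|x y|x y t t0]; last 2 first.
- exact: K0.
- exact: Khom.
by apply: measurable_kernel_comp hK _ _; [exact: measurable_snd|exact: measurable_fst].
Qed.

End homogeneous_kernels.

Ltac solve_meas := repeat match goal with
  | |- measurable_fun _ (fun _ => ?c) => exact: measurable_cst
  | |- measurable_fun _ (fun x => x) => exact: measurable_id
  | |- measurable_fun _ (fun x => x.1) => exact: measurable_fst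
  | |- measurable_fun _ (fun x => x.2) => exact: measurable_snd
  | H : measurable_fun setT ?v |- measurable_fun setT ?v => exact: H
  | H : measurable_fun setT (fun x => ?f x) |- measurable_fun setT (fun x => ?f x) => exact: H
  | |- measurable_fun _ (fun x => (_ x)%:E) => apply/measurable_EFinP
  | |- measurable_fun _ (fun x => _%:E) => apply/measurable_EFinP
  | |- measurable_fun _ (fun x => (_ ^+ _)%R) => apply: measurable_funX
  | |- measurable_fun _ (fun x => (_ - _)%R) => apply: measurable_funB
  | |- measurable_fun _ (fun x => (_ + _)%R) => apply: measurable_funD
  | |- measurable_fun _ (fun x => (_ * _)%R) => apply: measurable_funM
  | |- measurable_fun _ (fun x => (_ * _)%E) => apply: emeasurable_funM
  | |- measurable_fun _ (fun x => (_ + _)%R) => apply: emeasurable_funD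
  | |- measurable_fun _ (fun x => adde _ _) => apply: emeasurable_funD
  | |- measurable_fun _ (fun x => (_ `^ _)%R) => apply: (measurableT_comp (measurable_powR _))
  | H : measurable_fun setT ?v |- measurable_fun _ (fun x => ?v _) => apply: (measurableT_comp H)
  end.

Ltac solve_ge0 := repeat match goal with
  | |- forall _, _ => move=> ?
  | |- is_true (0%R <= (_)%:E)%E => rewrite lee_fin
  | |- is_true (0%R <= _ ^+ 2)%R => exact: sqr_ge0
  | |- is_true (0%R <= _ `^ _)%R => exact: powR_ge0
  | H : is_true (0%R < ?c)%R |- is_true (0%R <= ?c)%R => exact: ltW
  | H : is_true (0%R <= ?c)%R |- is_true (0%R <= ?c)%R => exact: H
  | |- is_true (0%R <= _ + _)%R => apply: addr_ge0
  | |- is_true (0%R <= _ * _)%R => apply: mulr_ge0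
  | |- is_true (0%R <= _^-1)%R => rewrite invr_ge0
  | |- is_true (0%R <= _ * _)%E => apply: mule_ge0
  | |- is_true (0%R <= _ + _)%E => apply: adde_ge0
  end.

(** * Ground state identity along a ray *)

Section ray_integrals.
Context {R : realType} (alpha : R).
Notation mu := (@lebesgue_measure R).
Local Open Scope ereal_scope.
Notation Rpos := (@Rpos R).
Implicit Type (f g v w : R -> R).

(** The radial measure x^(-alpha) dx left over by [kernel_polar]; for alpha = 1 it is the Haar
    measure dx/x. *)
Definition wint f : \bar R := \int[mu]_(x in Rpos) ((x `^ (- alpha))%:E * (f x)%:E).

Lemma eq_wint f g : (forall x, (0 < x)%R -> f x = g x) -> wint f = wint g.
Proof. by move=> fg; apply: eq_integral_Rpos => x x0; rewrite fg. Qed.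

Lemma wint_ge0 f : (forall x, 0 <= f x)%R -> 0 <= wint f.
Proof. by move=> f0; apply: integral_ge0 => x _; rewrite mule_ge0// lee_fin// powR_ge0. Qed.

Lemma wintD f g : measurable_fun setT f -> measurable_fun setT g ->
  (forall x, 0 <= f x)%R -> (forall x, 0 <= g x)%R ->
  wint (fun x => f x + g x)%R = wint f + wint g.
Proof.
move=> mf mg f0 g0; rewrite /wint -ge0_integralD//; last 4 first.
- by move=> x _; rewrite mule_ge0// lee_fin// powR_ge0.
- by apply: measurable_funTS; solve_meas.
- by move=> x _; rewrite mule_ge0// lee_fin// powR_ge0.
- by apply: measurable_funTS; solve_meas.
by apply: eq_integral => x _; rewrite -!EFinM -EFinD mulrDr.
Qed.

Lemma wintZ c f : measurable_fun setT f -> (forall x, 0 <= f x)%R -> (0 <= c)%R ->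
  wint (fun x => c * f x)%R = c%:E * wint f.
Proof.
move=> mf f0 c0; rewrite /wint -ge0_integralZl//; last 2 first.
- by apply: measurable_funTS; solve_meas.
- by move=> x _; rewrite mule_ge0// lee_fin// powR_ge0.
by apply: eq_integral => x _; rewrite EFinM muleCA.
Qed.

Lemma wint_dilation t f : measurable_fun setT f -> (forall x, 0 <= f x)%R -> (0 < t)%R ->
  wint (fun x => f (t * x)%R) = (t `^ (alpha - 1))%:E * wint f.
Proof.
move=> mf f0 t0; rewrite /wint (@integral_Rpos_power_dilation _ alpha t (fun x => (f x)%:E))//.
by solve_meas.
Qed.

(* The usual ground state identity, with the negative terms moved to the other
   side so that it can be integrated in the extended reals. *)
Lemma ground_state_pointwise (a b p q : R) : (0 < p)%R -> (0 < q)%R ->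
  ((a - b) ^+ 2 + (q / p) * a ^+ 2 + (p / q) * b ^+ 2 =
   (p * q) * (a / p - b / q) ^+ 2 + a ^+ 2 + b ^+ 2)%R.
Proof. by move=> p0 q0; field; rewrite !gt_eqF. Qed.

(** Integrate [ground_state_pointwise] with p = 1 and q = t^rho. Dilation turns the terms in v(t
    x)^2 into t^(alpha-1) times the integral A of v^2, and the multiples of A combine to 1 - q -
    t^(alpha-1)/q + t^(alpha-1), which factors as stated. *)
Lemma ray_identity (rho t : R) v : measurable_fun setT v -> (0 < t)%R ->
  wint (fun x => v x ^+ 2)%R < +oo ->
  wint (fun x => (v x - v (t * x)) ^+ 2)%R =
  wint (fun x => t `^ rho * (v x - v (t * x) / t `^ rho) ^+ 2)%R +
  ((1 - t `^ rho) * (1 - t `^ (alpha - 1 - rho)))%:E * wint (fun x => v x ^+ 2)%R.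
Proof.
move=> mv t0 Afin; have tp : (0 < t `^ rho)%R by rewrite powR_gt0.
have Age0 : 0 <= wint (fun x => v x ^+ 2)%R by apply: wint_ge0 => x; exact: sqr_ge0.
have mvt : measurable_fun setT (fun x => v (t * x)%R) by solve_meas.
have tV : (0 <= (t `^ rho)^-1)%R by rewrite invr_ge0 ltW.
have E : wint (fun x =>
      (v x - v (t * x)) ^+ 2 + t `^ rho * v x ^+ 2 + (t `^ rho)^-1 * v (t * x) ^+ 2)%R =
   wint (fun x => t `^ rho * (v x - v (t * x) / t `^ rho) ^+ 2 + v x ^+ 2 + v (t * x)%R ^+ 2)%R.
  apply: eq_wint => x x0.
  by have := ground_state_pointwise (v x) (v (t * x)%R) ltr01 tp; rewrite !divr1 !mul1r.
move: E; rewrite !wintD ?wintZ; try by [solve_meas|solve_ge0].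
rewrite (@wint_dilation t (fun x => v x ^+ 2)%R)//; last 2 first.
- by solve_meas.
- by move=> x; exact: sqr_ge0.
have Jge0 : 0 <= wint (fun x => (v x - v (t * x)) ^+ 2)%R by apply: wint_ge0 => x; exact: sqr_ge0.
have -> : (t `^ (alpha - 1 - rho) = t `^ (alpha - 1) / t `^ rho)%R.
  by rewrite powRB ?(gt_eqF t0) ?implybT.
have Qge0 : 0 <= (t `^ rho)%:E * wint (fun x => (v x - v (t * x) / t `^ rho) ^+ 2)%R.
  by rewrite mule_ge0 ?lee_fin ?(ltW tp)//; apply: wint_ge0 => x; exact: sqr_ge0.
move: Jge0 Qge0 Age0 Afin.
move: (wint (fun x => (v x - v (t * x)) ^+ 2)%R) => J.
move: ((t `^ rho)%:E * _) => Q.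
case: (wint _) => [A| |]// J0 Q0 _ _.
(* Since A is real, the equation makes J and Q infinite together; only when both are real must
   multiples of A be cancelled. *)
case: J J0 => [J| |]// J0; case: Q Q0 => [Q| |]// Q0; rewrite -?EFinM -?EFinD //.
move=> [E]; congr EFin; apply: (addIr (t `^ rho * A + (t `^ rho)^-1 * (t `^ (alpha - 1) * A))%R).
rewrite addrA E; field; exact: lt0r_neq0.
Qed.

End ray_integrals.

(** * Ground state identities on a quadrant *)

Section kernel_integrals.
Context {R : realType} (alpha : R).
Notation mu := (@lebesgue_measure R).
Local Open Scope ereal_scope.
Notation Rpos := (@Rpos R).
Notation wint := (wint alpha).
Implicit Type (v w : R -> R) (K : R -> R -> \bar R) (f g : R -> R -> R).

Definition kint K f : \bar R :=
  \int[mu]_(x in Rpos) \int[mu]_(y in Rpos) ((f x y)%:E * K x y).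

Lemma eq_kint K f g : (forall x y, (0 < x)%R -> (0 < y)%R -> f x y = g x y) -> kint K f = kint K g.
Proof.
by move=> fg; apply: eq_integral_Rpos => x x0; apply: eq_integral_Rpos => y y0; rewrite fg.
Qed.

Lemma kint_ge0 K f : homogeneous_kernel alpha K -> (forall x y, 0 <= f x y)%R -> 0 <= kint K f.
Proof.
move=> [_ K0 _] f0; apply: integral_ge0 => x _; apply: integral_ge0 => y _.
by rewrite mule_ge0// lee_fin.
Qed.

Let measurable_fK K f : homogeneous_kernel alpha K ->
  measurable_fun setT (fun z : R * R => f z.1 z.2) ->
  measurable_fun setT (fun z : R * R => (f z.1 z.2)%:E * K z.1 z.2).
Proof. by move=> [mK _ _] mf; solve_meas. Qed.

Lemma kintD K f g : homogeneous_kernel alpha K ->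
  measurable_fun setT (fun z : R * R => f z.1 z.2) ->
  measurable_fun setT (fun z : R * R => g z.1 z.2) ->
  (forall x y, 0 <= f x y)%R -> (forall x y, 0 <= g x y)%R ->
  kint K (fun x y => f x y + g x y)%R = kint K f + kint K g.
Proof.
move=> hK mf mg f0 g0; have [mK K0 _] := hK.
have pf x y : 0 <= (f x y)%:E * K x y by rewrite mule_ge0// lee_fin.
have pg x y : 0 <= (g x y)%:E * K x y by rewrite mule_ge0// lee_fin.
rewrite /kint -ge0_integralD//; last 4 first.
- by move=> x _; exact: integral_ge0.
- apply: measurable_funTS.
  by apply: (@measurable_fun_integral_Rpos _ (fun x y => (f x y)%:E * K x y)) => //;
    exact: measurable_fK.
- by move=> x _; exact: integral_ge0.
- apply: measurable_funTS.
  by apply: (@measurable_fun_integral_Rpos _ (fun x y => (g x y)%:E * K x y)) => //;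
    exact: measurable_fK.
apply: eq_integral_Rpos => x x0; rewrite -ge0_integralD//.
- by apply: eq_integral => y _; rewrite -ge0_muleDl ?lee_fin.
- apply: measurable_funTS.
  by apply: (measurable_fun_comp2 (F := fun x y => (f x y)%:E * K x y)) => //;
    exact: measurable_fK.
- apply: measurable_funTS.
  by apply: (measurable_fun_comp2 (F := fun x y => (g x y)%:E * K x y)) => //;
    exact: measurable_fK.
Qed.

Lemma kint_polar K f : homogeneous_kernel alpha K ->
  measurable_fun setT (fun z : R * R => f z.1 z.2) -> (forall x y, 0 <= f x y)%R ->
  kint K f = \int[mu]_(t in Rpos) (K 1%R t * wint (fun x => f x (t * x)%R)).
Proof.
move=> hK mf f0; rewrite /kint (@kernel_polar _ alpha _ (fun x y => (f x y)%:E))//.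
by solve_meas.
Qed.

Lemma kint_transposed K f : homogeneous_kernel alpha K ->
  measurable_fun setT (fun z : R * R => f z.1 z.2) -> (forall x y, 0 <= f x y)%R ->
  kint K f = kint (transposed_kernel K) (fun x y => f y x).
Proof.
move=> hK mf f0; have [mK K0 _] := hK.
rewrite /kint tonelli_Rpos//; last by move=> x y; rewrite mule_ge0// lee_fin.
exact: measurable_fK.
Qed.

(** In polar form an integrand that depends on x only through v, up to a function g of the ratio
    y/x, separates into a product of two single integrals. [kint_right] is the mirror image for
    terms carried by y. *)
Lemma kint_left K f (c : R) (g v : R -> R) : homogeneous_kernel alpha K ->
  measurable_fun setT (fun z : R * R => f z.1 z.2) -> (forall x y, 0 <= f x y)%R ->
  (0 <= c)%R -> measurable_fun setT g -> (forall t, 0 <= g t)%R ->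
  measurable_fun setT v ->
  (forall x t, (0 < x)%R -> (0 < t)%R -> f x (t * x) = c * g t * v x ^+ 2)%R ->
  kint K f =
  c%:E * (\int[mu]_(t in Rpos) ((g t)%:E * K 1%R t)) * wint (fun x => v x ^+ 2)%R.
Proof.
move=> hK mf f0 c0 mg g0 mv fE; have [mK K0 _] := hK.
have K1 : measurable_fun setT (fun t => K 1%R t).
  by apply: (measurable_fun_comp2 (F := K)) => //; solve_meas.
rewrite kint_polar//.
have W0 : 0 <= wint (fun x => v x ^+ 2)%R by apply: wint_ge0 => x; exact: sqr_ge0.
have I0 : 0 <= \int[mu]_(t in Rpos) ((g t)%:E * K 1%R t).
  by apply: integral_ge0 => t _; rewrite mule_ge0// lee_fin.
rewrite muleAC muleC -ge0_integralZr//; last 3 first.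
- by apply: measurable_funTS; solve_meas.
- by move=> t _; rewrite mule_ge0// lee_fin.
- by rewrite mule_ge0// lee_fin.
apply: eq_integral_Rpos => t t0.
rewrite (@eq_wint _ _ _ (fun x => c * g t * v x ^+ 2)%R); last by move=> x x0; rewrite fE.
rewrite wintZ//.
- by rewrite EFinM (muleC (g t)%:E) -!muleA; congr (_ * _); rewrite muleCA.
- by solve_meas.
- by move=> x; exact: sqr_ge0.
- by rewrite mulr_ge0.
Qed.

Lemma kint_right K f (c : R) (g v : R -> R) : homogeneous_kernel alpha K ->
  measurable_fun setT (fun z : R * R => f z.1 z.2) -> (forall x y, 0 <= f x y)%R ->
  (0 <= c)%R -> measurable_fun setT g -> (forall t, 0 <= g t)%R ->
  measurable_fun setT v ->
  (forall x t, (0 < x)%R -> (0 < t)%R -> f (t * x) x = c * g t * v x ^+ 2)%R ->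
  kint K f =
  c%:E * (\int[mu]_(t in Rpos) ((g t)%:E * K t 1%R)) * wint (fun x => v x ^+ 2)%R.
Proof.
move=> hK mf f0 c0 mg g0 mv fE; rewrite kint_transposed//.
apply: kint_left => //; first exact: homogeneous_transposed.
by apply: (measurable_fun_comp2 (F := f)) => //; solve_meas.
Qed.

(** Transfers a pointwise identity to integrals with three nonnegative terms on each side, so that
    no subtraction in the extended reals occurs. *)
Lemma kint_balance K f f1 f2 g g1 g2 : homogeneous_kernel alpha K ->
  measurable_fun setT (fun z : R * R => f z.1 z.2) ->
  measurable_fun setT (fun z : R * R => f1 z.1 z.2) ->
  measurable_fun setT (fun z : R * R => f2 z.1 z.2) ->
  measurable_fun setT (fun z : R * R => g z.1 z.2) ->
  measurable_fun setT (fun z : R * R => g1 z.1 z.2) ->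
  measurable_fun setT (fun z : R * R => g2 z.1 z.2) ->
  (forall x y, 0 <= f x y)%R -> (forall x y, 0 <= f1 x y)%R -> (forall x y, 0 <= f2 x y)%R ->
  (forall x y, 0 <= g x y)%R -> (forall x y, 0 <= g1 x y)%R -> (forall x y, 0 <= g2 x y)%R ->
  (forall x y, 0 < x -> 0 < y -> f x y + (f1 x y + f2 x y) = g x y + (g1 x y + g2 x y))%R ->
  kint K f + (kint K f1 + kint K f2) = kint K g + (kint K g1 + kint K g2).
Proof.
move=> hK mf mf1 mf2 mg mg1 mg2 f0 f10 f20 g0 g10 g20 E.
have f120 x y : (0 <= f1 x y + f2 x y)%R by exact: addr_ge0.
have g120 x y : (0 <= g1 x y + g2 x y)%R by exact: addr_ge0.
have ef := etrans (kintD hK mf (measurable_funD mf1 mf2) f0 f120)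
  (congr1 (adde (kint K f)) (kintD hK mf1 mf2 f10 f20)).
have eg := etrans (kintD hK mg (measurable_funD mg1 mg2) g0 g120)
  (congr1 (adde (kint K g)) (kintD hK mg1 mg2 g10 g20)).
exact: etrans (esym ef) (etrans (eq_kint K E) eg).
Qed.

(** This is [ground_state_pointwise] with p = x^rho and q = r y^rho, the ground state on the two
    half-lines, integrated against K. The ratios q/p and p/q depend only on y/x, so the
    single-variable terms factor by [kint_left] and [kint_right]. *)
Lemma offdiagonal_identity K (rho r : R) v w : homogeneous_kernel alpha K -> (0 < r)%R ->
  measurable_fun setT v -> measurable_fun setT w ->
  kint K (fun x y => (v x - w y) ^+ 2)%R
  + (r%:E * (\int[mu]_(t in Rpos) ((t `^ rho)%:E * K 1%R t)) * wint (fun x => v x ^+ 2)%R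
  + r^-1%:E * (\int[mu]_(t in Rpos) ((t `^ rho)%:E * K t 1%R)) * wint (fun x => w x ^+ 2)%R) =
  kint K (fun x y =>
    r * (x `^ rho * y `^ rho) * (v x * x `^ (- rho) - r^-1 * (w y * y `^ (- rho))) ^+ 2)%R
  + (\int[mu]_(t in Rpos) K 1%R t * wint (fun x => v x ^+ 2)%R
  + \int[mu]_(t in Rpos) K t 1%R * wint (fun x => w x ^+ 2)%R).
Proof.
move=> hK r0 mv mw.
pose f1 x y : R := (r * (y `^ rho * x `^ (- rho)) * v x ^+ 2)%R.
pose f2 x y : R := (r^-1 * (x `^ rho * y `^ (- rho)) * w y ^+ 2)%R.
pose f3 x (y : R) : R := (v x ^+ 2)%R.
pose f4 (x : R) y : R := (w y ^+ 2)%R.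
have tE x t : (0 < x)%R -> (0 < t)%R -> ((t * x) `^ rho * x `^ (- rho) = t `^ rho)%R.
  move=> x0 t0; rewrite powRM ?ltW// -mulrA -powRD ?(gt_eqF x0) ?implybT//.
  by rewrite subrr powRr0 mulr1.
have E1 : kint K f1 =
    r%:E * (\int[mu]_(t in Rpos) ((t `^ rho)%:E * K 1%R t)) * wint (fun x => v x ^+ 2)%R.
  apply: kint_left; rewrite /f1 => //; try by [solve_meas|solve_ge0|exact: ltW].
  by move=> x t x0 t0; rewrite tE.
have E2 : kint K f2 =
    r^-1%:E * (\int[mu]_(t in Rpos) ((t `^ rho)%:E * K t 1%R)) * wint (fun x => w x ^+ 2)%R.
  apply: kint_right; rewrite /f2 => //; try by [solve_meas|solve_ge0|exact: ltW].
  by move=> x t x0 t0; rewrite tE.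
have one (h : R -> \bar R) : \int[mu]_(t in Rpos) h t = 1%:E * \int[mu]_(t in Rpos) (1%:E * h t).
  by rewrite mul1e; apply: eq_integral => t _; rewrite mul1e.
have E3 : kint K f3 = \int[mu]_(t in Rpos) K 1%R t * wint (fun x => v x ^+ 2)%R.
  rewrite one; apply: (@kint_left _ _ _ (cst 1%R)); rewrite /f3 /cst => //;
    try by [solve_meas|solve_ge0].
  by move=> x t _ _; rewrite !mul1r.
have E4 : kint K f4 = \int[mu]_(t in Rpos) K t 1%R * wint (fun x => w x ^+ 2)%R.
  rewrite one; apply: (@kint_right _ _ _ (cst 1%R)); rewrite /f4 /cst => //;
    try by [solve_meas|solve_ge0].
  by move=> x t _ _; rewrite !mul1r.
pose f5 x y : R := ((v x - w y) ^+ 2)%R.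
pose f6 x y : R :=
  (r * (x `^ rho * y `^ rho) * (v x * x `^ (- rho) - r^-1 * (w y * y `^ (- rho))) ^+ 2)%R.
have m1 : measurable_fun setT (fun z : R * R => f1 z.1 z.2) by rewrite /f1; solve_meas.
have m2 : measurable_fun setT (fun z : R * R => f2 z.1 z.2) by rewrite /f2; solve_meas.
have m3 : measurable_fun setT (fun z : R * R => f3 z.1 z.2) by rewrite /f3; solve_meas.
have m4 : measurable_fun setT (fun z : R * R => f4 z.1 z.2) by rewrite /f4; solve_meas.
have m5 : measurable_fun setT (fun z : R * R => f5 z.1 z.2) by rewrite /f5; solve_meas.
have m6 : measurable_fun setT (fun z : R * R => f6 z.1 z.2) by rewrite /f6; solve_meas.
have n1 x y : (0 <= f1 x y)%R by rewrite /f1; solve_ge0.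
have n2 x y : (0 <= f2 x y)%R by rewrite /f2; solve_ge0.
have n3 x y : (0 <= f3 x y)%R by rewrite /f3; solve_ge0.
have n4 x y : (0 <= f4 x y)%R by rewrite /f4; solve_ge0.
have n5 x y : (0 <= f5 x y)%R by rewrite /f5; solve_ge0.
have n6 x y : (0 <= f6 x y)%R by rewrite /f6; solve_ge0.
rewrite -E1 -E2 -E3 -E4 {E1 E2 E3 E4 one}.
apply: (kint_balance (f := f5) (g := f6)) => // x y x0 y0; rewrite /f1 /f2 /f3 /f4 /f5 /f6.
have p0 : (0 < x `^ rho)%R by rewrite powR_gt0.
have q0 : (0 < r * y `^ rho)%R by rewrite mulr_gt0// powR_gt0.
have := ground_state_pointwise (v x) (w y) p0 q0.
rewrite !powRN addrA => E; rewrite -[RHS]addrA in E *.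
rewrite [LHS](_ : _ = (v x - w y) ^+ 2 + r * y `^ rho / x `^ rho * v x ^+ 2 +
    x `^ rho / (r * y `^ rho) * w y ^+ 2)%R.
  by rewrite E; congr (_ + _)%R; field; rewrite !gt_eqF ?powR_gt0.
by field; rewrite !gt_eqF ?powR_gt0.
Qed.

Lemma measurable_diagonal_remainder K (rho : R) v : homogeneous_kernel alpha K ->
  measurable_fun setT v ->
  measurable_fun setT (fun t => K 1%R t *
    wint (fun x => t `^ rho * (v x - v (t * x) / t `^ rho) ^+ 2)%R).
Proof.
move=> hK mv; have [mK _ _] := hK.
have K1 : measurable_fun setT (fun t => K 1%R t).
  by apply: (measurable_fun_comp2 (F := K)) => //; solve_meas.
apply: emeasurable_funM => //.
apply: (eq_measurable_fun (fun t => \int[mu]_(x in Rpos)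
  ((x `^ (- alpha))%:E * (t `^ rho * (v x - v (t * x) * t `^ (- rho)) ^+ 2)%:E))).
  by move=> t _; apply: eq_wint => x _; rewrite powRN.
apply: (@measurable_fun_integral_Rpos _ (fun t x =>
  (x `^ (- alpha))%:E * (t `^ rho * (v x - v (t * x) * t `^ (- rho)) ^+ 2)%:E)).
  by solve_meas.
by solve_ge0.
Qed.

(** The symmetry of K reduces the quadrant to twice the region y < x, where the polar variable t
    ranges over (0, 1); [ray_identity] then applies at each fixed t, before the singularity at t = 1
    is integrated. *)
Lemma diagonal_identity K (rho : R) v : homogeneous_kernel alpha K ->
  (forall x y, K x y = K y x) -> (alpha - 1 = rho + rho)%R ->
  measurable_fun setT v -> wint (fun x => v x ^+ 2)%R < +oo ->
  kint K (fun x y => (v x - v y) ^+ 2)%R =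
  2%:E * ((\int[mu]_(t in `]0%R, 1%R[)
      (K 1%R t * wint (fun x => t `^ rho * (v x - v (t * x) / t `^ rho) ^+ 2)%R))
   + (\int[mu]_(t in `]0%R, 1%R[)
     (((1 - t `^ rho) * (1 - t `^ (alpha - 1 - rho)))%:E * K 1%R t)) * wint (fun x => v x ^+ 2)%R).
Proof.
move=> hK Ksym hrho mv vfin; have [mK K0 _] := hK.
(* The integrand restricted below the diagonal; on the diagonal itself the square vanishes, so [i]
   and its mirror image add up to it everywhere. *)
pose i x y : R := if (y < x)%R then ((v x - v y) ^+ 2)%R else 0%R.
have mi : measurable_fun setT (fun z : R * R => i z.1 z.2).
  by apply: measurable_fun_ifT; [apply: measurable_fun_ltr; solve_meas|solve_meas|solve_meas].
have i0 x y : (0 <= i x y)%R by rewrite /i; case: ifPn => // _; exact: sqr_ge0.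
have -> : kint K (fun x y => (v x - v y) ^+ 2)%R = 2%:E * kint K i.
  rewrite (_ : 2%:E = 1%:E + 1%:E)// ge0_muleDl ?lee_fin// !mul1e {2}(kint_transposed hK mi i0).
  rewrite (_ : transposed_kernel K = K); last first.
    by apply/funext => x; apply/funext => y; rewrite /transposed_kernel Ksym.
  have mi' : measurable_fun setT (fun z : R * R => i z.2 z.1).
    by apply: (measurable_fun_comp2 (F := i)) => //; solve_meas.
  have i0' x y : (0 <= i y x)%R by exact: i0.
  refine (etrans _ (kintD hK mi mi' i0 i0')).
  apply: eq_kint => x y _ _; rewrite /i; case: (ltgtP x y) => [_|_|->].
  - by rewrite add0r -opprB sqrrN.
  - by rewrite addr0.
  - by rewrite subrr expr0n addr0.
congr (_ * _); rewrite kint_polar//.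
have W0 : 0 <= wint (fun x => v x ^+ 2)%R by apply: wint_ge0 => x; exact: sqr_ge0.
have K1 : measurable_fun setT (fun t => K 1%R t).
  by apply: (measurable_fun_comp2 (F := K)) => //; solve_meas.
have mQ := measurable_diagonal_remainder rho hK mv.
(* With alpha - 1 - rho = rho the coefficient is a square, so its term may be integrated separately
   from the remainder. *)
have g0 (t : R) : (0 <= (1 - t `^ rho) * (1 - t `^ (alpha - 1 - rho)))%R.
  by rewrite hrho addrK -expr2 sqr_ge0.
rewrite -ge0_integralZr//; last 2 first.
- by apply: measurable_funTS; solve_meas.
- by move=> t _; rewrite mule_ge0// lee_fin.
rewrite -ge0_integralD//; last 4 first.
- by move=> t _; rewrite mule_ge0//; apply: wint_ge0; solve_ge0.
- exact: measurable_funTS.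
- by move=> t _; rewrite mule_ge0// mule_ge0// lee_fin.
- by apply: measurable_funTS; solve_meas.
rewrite -integral_Rpos_if_lt1; apply: eq_integral_Rpos => t t0.
case: ifPn => t1; last first.
  rewrite (@eq_wint _ _ _ (fun=> 0%R)); last first.
    by move=> x x0; rewrite /i gtr_pMl// (negbTE t1).
  by rewrite /wint integral0_eq ?mule0// => x _; rewrite mule0.
rewrite (@eq_wint _ _ _ (fun x => (v x - v (t * x)) ^+ 2)%R); last first.
  by move=> x x0; rewrite /i gtr_pMl// t1.
rewrite (@ray_identity _ alpha rho)// ge0_muleDr; last 2 first.
- by apply: wint_ge0; solve_ge0.
- by rewrite mule_ge0// lee_fin.
by congr (_ + _); rewrite muleA (muleC (K _ _)).
Qed.

End kernel_integrals.

(** * Finiteness of the kernel integrals *)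

Section power_integrals.
Context {R : realType}.
Notation mu := (@lebesgue_measure R).
Local Open Scope ereal_scope.
Notation Rpos := (@Rpos R).
Implicit Types (f F : R -> R).

Lemma FTC2_is_derive f F (c d : R) : (c < d)%R ->
  (forall x, c <= x <= d -> {for x, continuous f})%R ->
  (forall x, c <= x <= d -> is_derive x 1%R F (f x))%R ->
  \int[mu]_(x in `[c, d]) (f x)%:E = (F d - F c)%:E.
Proof.
move=> cd cf dF.
have cF x : (c <= x <= d)%R -> {for x, continuous F}.
  move=> xcd; have [dx _] := dF _ xcd.
  by apply/differentiable_continuous/derivable1_diffP.
rewrite EFinB; apply: continuous_FTC2 => //.
- by apply: continuous_in_subspaceT => x /[!inE]/=; rewrite in_itv/= => /cf.
- split.
  + by move=> x; rewrite in_itv/= => /andP[cx xd]; have [] := dF x; rewrite ?ltW.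
  + by apply: cvg_at_right_filter; apply: cF; rewrite lexx ltW.
  + by apply: cvg_at_left_filter; apply: cF; rewrite lexx ltW.
- move=> x; rewrite in_itv/= => /andP[cx xd]; rewrite derive1E.
  by have [] := dF x; rewrite ?ltW.
Qed.

(** Improper integrals by exhaustion: on each compact interval the integral is an increment of F,
    and nonnegativity lets the bound pass to the limit. *)
Lemma integral_bigcup_itv_le f F (c d : nat -> R) (M : R) :
  nonincreasing_seq c -> nondecreasing_seq d -> (forall n, c n < d n)%R ->
  measurable_fun setT f ->
  (forall n x, c n <= x <= d n -> 0 <= f x)%R ->
  (forall n x, c n <= x <= d n -> {for x, continuous f})%R ->
  (forall n x, c n <= x <= d n -> is_derive x 1%R F (f x))%R ->
  (forall n, F (d n) - F (c n) <= M)%R ->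
  \int[mu]_(x in \bigcup_n `[c n, d n]%classic) (f x)%:E <= M%:E.
Proof.
move=> nc nd cd mf f0 cf dF FM.
have nndF : nondecreasing_seq (fun n => `[c n, d n]%classic).
  move=> m n mn; apply/subsetPset => x /=; rewrite !in_itv/= => /andP[cx xd].
  by rewrite (le_trans (nc _ _ mn))//= (le_trans xd (nd _ _ mn)).
have h : \int[mu]_(x in `[c n, d n]) (f x)%:E @[n --> \oo] -->
  \int[mu]_(x in \bigcup_n `[c n, d n]%classic) (f x)%:E.
  apply: (@ge0_nondecreasing_set_cvg_integral _ (measurableTypeR R) R
    (fun n => `[c n, d n]%classic) (EFin \o f) mu) => //.
  by move=> n; apply/measurable_EFinP; exact: measurable_funTS.
rewrite -(cvg_lim _ h)//; apply: lime_le; first by apply/cvg_ex; eexists; exact: h.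
near=> n; rewrite (FTC2_is_derive (cd n) (cf n) (dF n)) lee_fin; exact: FM.
Unshelve. all: by end_near. Qed.

Lemma is_derive_powR_primitive (b x : R) : (b + 1 != 0)%R -> (0 < x)%R ->
  is_derive x 1%R (fun x : R => (b + 1)^-1 * x `^ (b + 1))%R (x `^ b)%R.
Proof.
move=> b1 x0; have h := @is_derive1_powR R (b + 1)%R x x0.
have -> : (x `^ b = (b + 1)^-1 *: ((b + 1) * x `^ (b + 1 - 1)))%R.
  by rewrite /GRing.scale/= mulrA mulVf// mul1r addrK.
exact: is_deriveZ.
Qed.

Lemma continuous_powR (b x : R) : (0 < x)%R -> {for x, continuous (fun x : R => x `^ b)%R}.
Proof.
move=> x0; have [dx _] := @is_derive1_powR R b x x0.
by apply/differentiable_continuous/derivable1_diffP.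
Qed.

Lemma powR_le1 (b x : R) : (0 < x)%R -> (x < 1)%R -> (0 <= b)%R -> (x `^ b <= 1)%R.
Proof.
move=> x0 x1 b0; have -> : (1 = 1 `^ b :> R)%R by rewrite powR1.
by apply: ge0_ler_powR => //; rewrite ?nnegrE ?ler01// ltW.
Qed.

(** The shift by 3 keeps 1/(n+3) below 1/2, so that every interval of the exhaustion is
    nondegenerate. *)
Lemma bigcup_itv01 : `]0%R, 1%R[%classic =
  \bigcup_n `[((n.+3%:R)^-1)%R : R, (1 - (n.+3%:R)^-1)%R : R]%classic.
Proof.
apply/seteqP; split => x /=.
  rewrite in_itv/= => /andP[x0 x1].
  have [n Hn] : exists n : nat, (Num.max x^-1 (1 - x)^-1 < n%:R)%R.
    by exists (Num.truncn (Num.max x^-1 (1 - x)^-1)%R).+1; exact: truncnS_gt.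
  move: Hn; rewrite gt_max => /andP[h1 h2].
  have n3 : (n%:R <= n.+3%:R :> R)%R by rewrite ler_nat -addn3 leq_addr.
  exists n => //=; rewrite in_itv/=; apply/andP; split.
    by rewrite invf_ple ?posrE// ltW// (lt_le_trans h1).
  by rewrite lerBrDl -lerBrDr invf_ple ?posrE ?subr_gt0// ltW// (lt_le_trans h2).
move=> [n _] /=; rewrite !in_itv/= => /andP[h1 h2].
by rewrite (lt_le_trans _ h1) ?invr_gt0// (le_lt_trans h2)// gtrBl invr_gt0.
Qed.

Lemma inv_nat3 (n : nat) : (0 < (n.+3%:R)^-1 :> R)%R /\ ((n.+3%:R)^-1 <= 3^-1 :> R)%R.
Proof. by split; [rewrite invr_gt0|rewrite lef_pV2 ?posrE// ler_nat]. Qed.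

Lemma integral_01_le f F (M : R) : measurable_fun setT f ->
  (forall x : R, 0 < x < 1 -> 0 <= f x)%R ->
  (forall x : R, 0 < x < 1 -> {for x, continuous f})%R ->
  (forall x : R, 0 < x < 1 -> is_derive x 1%R F (f x))%R ->
  (forall x : R, 0 < x < 1 -> `|F x| <= M)%R ->
  \int[mu]_(x in `]0%R, 1%R[) (f x)%:E < +oo.
Proof.
move=> mf f0 cf dF FM; rewrite bigcup_itv01; apply: le_lt_trans (ltry (M + M)).
have nin n (x : R) : ((n.+3%:R)^-1 <= x <= 1 - (n.+3%:R)^-1)%R -> (0 < x < 1)%R.
  have [] := inv_nat3 n; move: ((n.+3%:R)^-1)%R => e h1 h2 /andP[h3 h4].
  by apply/andP; split; lra.
apply: (@integral_bigcup_itv_le f F (fun n => (n.+3%:R)^-1)%R (fun n => 1 - (n.+3%:R)^-1)%R).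
- by move=> m n mn; rewrite lef_pV2 ?posrE// ler_nat.
- by move=> m n mn; rewrite lerD2l lerN2 lef_pV2 ?posrE// ler_nat.
- by move=> n; have [] := inv_nat3 n; move: ((n.+3%:R)^-1)%R => e h1 h2; lra.
- by [].
- by move=> n x /nin; exact: f0.
- by move=> n x /nin; exact: cf.
- by move=> n x /nin; exact: dF.
move=> n; apply: lerD.
  apply: le_trans (ler_norm _) (FM _ (nin n _ _)).
  by have [] := inv_nat3 n; move: ((n.+3%:R)^-1)%R => e h1 h2; rewrite lexx andbT; lra.
apply: le_trans (ler_norm _) _; rewrite normrN; apply: FM; apply: (nin n).
by have [] := inv_nat3 n; move: ((n.+3%:R)^-1)%R => e h1 h2; rewrite lexx /=; lra.
Qed.

Lemma integral_powR_01 (b : R) : (-1 < b)%R ->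
  \int[mu]_(x in `]0%R, 1%R[) (x `^ b)%:E < +oo.
Proof.
move=> b1; have b0 : (0 < b + 1)%R by lra.
apply: (@integral_01_le _ (fun x => (b + 1)^-1 * x `^ (b + 1))%R (b + 1)^-1)%R.
- exact: measurable_powR.
- by move=> x _; exact: powR_ge0.
- by move=> x /andP[x0 _]; exact: continuous_powR.
- by move=> x /andP[x0 _]; apply: is_derive_powR_primitive; rewrite ?gt_eqF.
move=> x /andP[x0 x1]; rewrite ger0_norm ?mulr_ge0 ?powR_ge0 ?invr_ge0 ?(ltW b0)//.
by rewrite ler_piMr ?invr_ge0 ?(ltW b0)// powR_le1// ltW.
Qed.

Lemma integral_onem_powR_01 (b : R) : (-1 < b)%R ->
  \int[mu]_(x in `]0%R, 1%R[) ((1 - x) `^ b)%:E < +oo.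
Proof.
move=> b1; have b0 : (0 < b + 1)%R by lra.
have mx : measurable_fun setT (fun x : R => 1 - x)%R by solve_meas.
apply: (@integral_01_le _ (fun x => - ((b + 1)^-1 * (1 - x) `^ (b + 1)))%R (b + 1)^-1)%R.
- by solve_meas.
- by move=> x _; exact: powR_ge0.
- move=> x /andP[x0 x1].
  have x10 : (0 < 1 - x)%R by rewrite subr_gt0.
  have h1 : is_derive x (1 : R)%R (fun x : R => 1 - x)%R (0 - 1)%R by apply: is_deriveB.
  have [dx _] := @is_derive1_comp _
    (fun x : R => x `^ b)%R (fun x : R => 1 - x)%R x _ _ (is_derive1_powR b x10) h1.
  exact/differentiable_continuous/derivable1_diffP.
- move=> x /andP[x0 x1].
  have x10 : (0 < 1 - x)%R by rewrite subr_gt0.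
  have h := @is_derive_powR_primitive b _ (negbT (gt_eqF b0)) x10.
  have h1 : is_derive x (1 : R)%R (fun x : R => 1 - x)%R (0 - 1)%R by apply: is_deriveB.
  have h2 := @is_derive1_comp _
    (fun x : R => (b + 1)^-1 * x `^ (b + 1))%R (fun x : R => 1 - x)%R x _ _ h h1.
  have := is_deriveN h2.
  by rewrite sub0r mulrN1 opprK.
move=> x /andP[x0 x1]; rewrite normrN ger0_norm ?mulr_ge0 ?powR_ge0 ?invr_ge0 ?(ltW b0)//.
by rewrite ler_piMr ?invr_ge0 ?(ltW b0)// powR_le1 ?subr_gt0 ?ltrBlDr ?ltrDl// ltW.
Qed.

Lemma integral_powR_1y (b : R) : (b < -1)%R ->
  \int[mu]_(x in `[1%R, +oo[) (x `^ b)%:E < +oo.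
Proof.
move=> b1; have b0 : (b + 1 < 0)%R by lra.
have -> : `[1%R, +oo[%classic = \bigcup_n `[1%R, (1 + n.+1%:R)%R : R]%classic.
  apply/seteqP; split => x /=; rewrite in_itv/= andbT.
    move=> x1; exists (Num.truncn x) => //=; rewrite in_itv/= x1/=.
    by rewrite ler_wpDl// ltW// truncnS_gt.
  by move=> [n _] /=; rewrite in_itv/= => /andP[].
apply: le_lt_trans (ltry (- (b + 1)^-1)%R).
apply: (@integral_bigcup_itv_le _ (fun x => (b + 1)^-1 * x `^ (b + 1))%R).
- by [].
- by move=> m n mn; rewrite lerD2l ler_nat.
- by move=> n; rewrite ltrDl.
- exact: measurable_powR.
- by move=> n x _; exact: powR_ge0.
- by move=> n x /andP[x0 _]; apply: continuous_powR; exact: lt_le_trans x0.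
- move=> n x /andP[x0 _]; apply: is_derive_powR_primitive; rewrite ?lt_eqF//.
  exact: lt_le_trans x0.
move=> n; rewrite powR1 mulr1 lerBlDr addNr mulr_le0_ge0// ?powR_ge0//.
by rewrite invr_le0 ltW.
Qed.

Lemma integral_inv (c d : R) : (0 < c)%R -> (c < d)%R ->
  \int[mu]_(x in `[c, d]) (x^-1)%:E = (ln d - ln c)%:E.
Proof.
move=> c0 cd; apply: FTC2_is_derive => // x /andP[cx xd].
  by apply: inv_continuous; rewrite gt_eqF// (lt_le_trans c0).
by apply: is_derive1_ln; rewrite (lt_le_trans c0).
Qed.

End power_integrals.

Section logarithm_near_diagonal.
Context {R : realType}.
Notation mu := (@lebesgue_measure R).
Local Open Scope ereal_scope.
Notation Rpos := (@Rpos R).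

Lemma ge0_le_integral_lty (D : set R) (f g : R -> \bar R) : measurable D ->
  measurable_fun setT f -> measurable_fun setT g ->
  (forall x, D x -> 0 <= f x) -> (forall x, D x -> f x <= g x) ->
  \int[mu]_(x in D) g x < +oo -> \int[mu]_(x in D) f x < +oo.
Proof.
move=> mD mf mg f0 fg; apply: le_lt_trans; apply: ge0_le_integral => //.
- exact: measurable_funTS.
- exact: measurable_funTS.
Qed.

Lemma integral_lin2_lty (D : set R) (a b : R) (f g : R -> R) : measurable D ->
  measurable_fun setT f -> measurable_fun setT g -> (0 <= a)%R -> (0 <= b)%R ->
  (forall x, D x -> 0 <= f x)%R -> (forall x, D x -> 0 <= g x)%R ->
  \int[mu]_(x in D) (f x)%:E < +oo -> \int[mu]_(x in D) (g x)%:E < +oo ->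
  \int[mu]_(x in D) (a * f x + b * g x)%:E < +oo.
Proof.
move=> mD mf mg a0 b0 f0 g0 If Ig.
under eq_integral do rewrite EFinD !EFinM.
rewrite ge0_integralD//; last 4 first.
- by move=> x Dx; rewrite mule_ge0// lee_fin ?f0.
- by apply: measurable_funTS; solve_meas.
- by move=> x Dx; rewrite mule_ge0// lee_fin ?g0.
- by apply: measurable_funTS; solve_meas.
rewrite !ge0_integralZl//; try by [apply: measurable_funTS; solve_meas|
  move=> x Dx; rewrite lee_fin ?f0 ?g0].
by rewrite lte_add_pinfty// lte_mul_pinfty// ?lee_fin// integral_ge0.
Qed.

Lemma integral_Rpos_split (f : R -> \bar R) : measurable_fun setT f ->
  (forall x, 0 <= f x) ->
  \int[mu]_(x in Rpos) f x = \int[mu]_(x in `]0%R, 1%R[) f x + \int[mu]_(x in `[1%R, +oo[) f x.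
Proof.
move=> mf f0; rewrite -ge0_integral_setU//=.
- congr (integral _ _ _); apply/seteqP; split => x /=; rewrite RposE !in_itv/= andbT.
    by move=> ->; case: (ltP x 1%R); [left|right].
  by move=> [/andP[]//|]; exact: lt_le_trans.
- exact: measurable_funTS.
- apply/disj_set2P; apply/seteqP; split => x //=; rewrite !in_itv/= andbT.
  by move=> [/andP[_ x1] /(lt_le_trans x1)]; rewrite ltxx.
Qed.

(** Applying ln s < s at s = t^e and s = t^(-e) bounds e |ln t|, whichever the sign of ln t. It
    trades the logarithm for a small power at 0 and at infinity. *)
Lemma sqr_ln_le_powR (e t : R) : (0 < e)%R -> (0 < t)%R ->
  (ln t ^+ 2 <= 2 / e ^+ 2 * (t `^ (2 * e) + t `^ (- (2 * e))))%R.
Proof.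
move=> e0 t0.
have h1 := ltW (ln_sublinear (powR_gt0 e t0)).
have h2 := ltW (ln_sublinear (powR_gt0 (- e)%R t0)).
rewrite !ln_powR in h1 h2.
rewrite -mulrN !(mulrC 2%R) !powRrM !(powR_mulrn 2)//; last 2 first.
- exact: powR_ge0.
- exact: powR_ge0.
have := powR_ge0 t e; have := powR_ge0 t (- e)%R.
move: (t `^ e)%R (t `^ (- e))%R h1 h2 => p q h1 h2 q0 p0.
have : ((e * ln t) ^+ 2 <= 2 * (p ^+ 2 + q ^+ 2))%R.
  rewrite mulNr in h2; move: (e * ln t)%R h1 h2 => z h1 h2.
  by case: (leP 0%R z) => z0; nra.
rewrite exprMn -ler_pdivlMl ?exprn_gt0// => /le_trans; apply.
by rewrite mulrA (mulrC _ 2%R).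
Qed.

(** -e ln t = ln(t^(-e)) <= t^(-e) - 1 = t^(-e) (1 - t^e) <= t^(-e) (1 - t), the last step because t
    <= t^e for e <= 1. The bound keeps the double zero at t = 1 and loses only a small power at
    0. *)
Lemma sqr_ln_le_onem (e t : R) : (0 < e <= 1)%R -> (0 < t < 1)%R ->
  (ln t ^+ 2 <= (e ^+ 2)^-1 * (t `^ (- (2 * e)) * (1 - t) ^+ 2))%R.
Proof.
move=> /andP[e0 e1] /andP[t0 t1].
have h2 : (- e * ln t <= t `^ (- e) * (1 - t))%R.
  have q0 : (0 < t `^ (- e))%R by rewrite powR_gt0.
  have h : (- e * ln t <= t `^ (- e) - 1)%R.
    by rewrite -ln_powR -[X in ln X](subrKC 1) le_ln1Dx// ltrBDl addrN.
  apply: (le_trans h).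
  have te : (t <= t `^ e)%R by apply: ger1_powR => //; rewrite t0 ltW.
  have pq : (t `^ (- e) * t `^ e = 1)%R by rewrite -powRD ?(gt_eqF t0) ?implybT// addNr powRr0.
  by rewrite mulrBr mulr1 lerB// -pq ler_wpM2l// ltW.
rewrite -mulrN (mulrC 2%R) powRrM (powR_mulrn 2) ?powR_ge0//.
have l0 : (ln t <= 0)%R by rewrite ln_le0// ltW.
rewrite -exprMn -ler_pdivrMl ?invr_gt0 ?exprn_gt0// invrK -exprMn.
rewrite -(sqrrN (e * _)) -mulNr ler_sqr ?nnegrE//.
- by rewrite mulr_le0// oppr_le0 ltW.
- by rewrite mulr_ge0 ?powR_ge0// subr_ge0 ltW.
Qed.

Lemma powR_half_le (a t : R) : (2^-1 <= t < 1)%R -> (t `^ a <= 1 + 2^-1 `^ a)%R.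
Proof.
move=> /andP[th t1]; have t0 : (0 < t)%R by rewrite (lt_le_trans _ th).
have [a0|a0] := leP 0%R a.
  by rewrite (le_trans (powR_le1 t0 t1 a0))// lerDl powR_ge0.
rewrite (@le_trans _ _ (2^-1 `^ a)%R)// ?lerDr//.
rewrite -[a]opprK !(powRN _ (- a)) lef_pV2 ?posrE ?powR_gt0//.
have Na0 : (0 <= - a)%R by rewrite oppr_ge0 ltW.
by apply: ge0_ler_powR => //; rewrite nnegrE ?invr_ge0// ltW.
Qed.

(** On each half of (0, 1) one of the two factors is bounded, so a beta integrand is dominated by a
    sum of single powers. *)
Lemma powR_beta_le (a b t : R) : (0 < t < 1)%R ->
  (t `^ a * (1 - t) `^ b <= (1 + 2^-1 `^ b) * t `^ a + (1 + 2^-1 `^ a) * (1 - t) `^ b)%R.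
Proof.
move=> /andP[t0 t1].
have := powR_ge0 (1 - t)%R b; have := powR_ge0 t a.
have := powR_ge0 2^-1%R b; have := powR_ge0 2^-1%R a.
have [th|th] := leP 2^-1%R t.
  have : (t `^ a <= 1 + 2^-1 `^ a)%R by rewrite powR_half_le// th.
  by move: (t `^ a)%R ((1 - t) `^ b)%R (2^-1 `^ a)%R (2^-1 `^ b)%R => *; nra.
have : ((1 - t) `^ b <= 1 + 2^-1 `^ b)%R by apply: powR_half_le; lra.
by move: (t `^ a)%R ((1 - t) `^ b)%R (2^-1 `^ a)%R (2^-1 `^ b)%R => *; nra.
Qed.

Lemma measurable_ln_sqr : measurable_fun setT (fun t : R => ln t ^+ 2)%R.
Proof. by have ml := @measurable_ln R; solve_meas. Qed.

(** By [sqr_ln_le_onem] the logarithm contributes (1-t)^2 against the singularity (1-t)^(-alpha-1),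
    leaving 1 - alpha > -1, while s > -1 leaves room for the loss t^(-2e) at 0. *)
Lemma integral_01_kernel_ln (alpha c : R) (K : R -> \bar R) (s : R) : (alpha < 2)%R -> (0 < c)%R ->
  measurable_fun setT K -> (forall t, 0 <= K t) ->
  (forall t, (0 < t < 1)%R -> K t <= (c * (1 - t) `^ (- alpha - 1))%:E) -> (-1 < s)%R ->
  \int[mu]_(t in `]0%R, 1%R[) ((t `^ s * ln t ^+ 2)%:E * K t) < +oo.
Proof.
(* The choice e <= (s+1)/4 keeps s - 2e above -1, and e <= 1 is what [sqr_ln_le_onem] asks for. *)
move=> alpha2 c0 mK K0 Kc s1; have ml2 := measurable_ln_sqr; pose e := Num.min 1%R ((s + 1) / 4)%R.
have e0 : (0 < e)%R by rewrite lt_min ltr01/= divr_gt0//; lra.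
have e1 : (e <= 1)%R by rewrite ge_min lexx.
have es : (-1 < s - 2 * e)%R.
  have : (e <= (s + 1) / 4)%R by rewrite ge_min lexx orbT.
  by lra.
pose a := (s - 2 * e)%R; pose b := (1 - alpha)%R.
have b1 : (-1 < b)%R by rewrite /b; lra.
have mx : measurable_fun setT (fun x : R => 1 - x)%R by solve_meas.
pose C := (c * (e ^+ 2)^-1)%R.
have C0 : (0 <= C)%R by rewrite mulr_ge0 ?invr_ge0 ?exprn_ge0 ?ltW.
apply: (@ge0_le_integral_lty _ _ (fun t =>
  (C * (1 + 2^-1 `^ b) * t `^ a + C * (1 + 2^-1 `^ a) * (1 - t) `^ b)%R%:E)).
- exact: measurable_itv.
- by solve_meas.
- by solve_meas.
- by move=> t _; rewrite mule_ge0// lee_fin mulr_ge0 ?powR_ge0 ?sqr_ge0.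
- move=> t /=; rewrite in_itv/= => t01; have /andP[t0 t1] := t01.
  apply: (@le_trans _ _ ((t `^ s * ln t ^+ 2)%:E * (c * (1 - t) `^ (- alpha - 1))%:E)).
    by apply: lee_wpmul2l; [rewrite lee_fin mulr_ge0 ?powR_ge0 ?sqr_ge0|exact: Kc].
  rewrite -EFinM lee_fin.
  apply: (@le_trans _ _ (C * (t `^ a * (1 - t) `^ b))%R); last first.
    by rewrite -!(mulrA C) -mulrDr ler_wpM2l// powR_beta_le.
  have u0 : (0 < 1 - t)%R by rewrite subr_gt0.
  have aE : (t `^ a = t `^ s * t `^ (- (2 * e)))%R by rewrite -powRD ?(gt_eqF t0) ?implybT.
  have bE : ((1 - t) `^ b = (1 - t) ^+ 2 * (1 - t) `^ (- alpha - 1))%R.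
    rewrite -(powR_mulrn 2) ?ltW// -powRD ?(gt_eqF u0) ?implybT//; congr (_ `^ _)%R.
    by rewrite /b; lra.
  have h := sqr_ln_le_onem (e := e) (t := t).
  rewrite e0 e1 t01 in h; have {h} := h isT isT => h.
  rewrite aE bE /C.
  have p0 : (0 <= t `^ s * (c * (1 - t) `^ (- alpha - 1)))%R by rewrite !mulr_ge0 ?powR_ge0 ?ltW.
  have := ler_wpM2l p0 h.
  by congr (_ <= _)%R; ring.
- apply: integral_lin2_lty => //; try by [solve_meas|move=> x _; exact: powR_ge0].
  + by rewrite mulr_ge0// addr_ge0// powR_ge0.
  + by rewrite mulr_ge0// addr_ge0// powR_ge0.
  + exact: integral_powR_01.
  + exact: integral_onem_powR_01.
Qed.

End logarithm_near_diagonal.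

Section finite_kernel_integrals.
Context {R : realType}.
Notation mu := (@lebesgue_measure R).
Local Open Scope ereal_scope.
Notation Rpos := (@Rpos R).

Lemma integralD_lty (D : set R) (f g : R -> \bar R) : measurable D ->
  measurable_fun setT f -> measurable_fun setT g ->
  (forall x, 0 <= f x) -> (forall x, 0 <= g x) ->
  \int[mu]_(x in D) f x < +oo -> \int[mu]_(x in D) g x < +oo ->
  \int[mu]_(x in D) (f x + g x) < +oo.
Proof.
move=> mD mf mg f0 g0 If Ig; rewrite ge0_integralD//.
- exact: lte_add_pinfty.
- exact: measurable_funTS.
- exact: measurable_funTS.
Qed.

Lemma integralZl_lty (D : set R) (c : R) (f : R -> \bar R) : measurable D ->
  measurable_fun setT f -> (forall x, 0 <= f x) -> (0 <= c)%R ->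
  \int[mu]_(x in D) f x < +oo -> \int[mu]_(x in D) (c%:E * f x) < +oo.
Proof.
move=> mD mf f0 c0 If; rewrite ge0_integralZl//; last exact: measurable_funTS.
by rewrite lte_mul_pinfty// ?lee_fin ?integral_ge0.
Qed.

(** With z = rho ln t this is |1 - exp z| <= |z| max(1, exp z), obtained from 1 + z <= exp z at z
    and -z. The factor t^0 gives both terms the shape treated by [integral_01_kernel_ln]. *)
Lemma sqr_onem_powR_le (rho t : R) : (0 < t)%R ->
  ((1 - t `^ rho) ^+ 2 <= rho ^+ 2 * (t `^ 0 * ln t ^+ 2 + t `^ (rho + rho) * ln t ^+ 2))%R.
Proof.
move=> t0; rewrite powRr0 mul1r powRD ?(gt_eqF t0) ?implybT//.
have pE : (t `^ rho = expR (rho * ln t))%R by rewrite /powR gt_eqF.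
have h1 := expR_ge1Dx (rho * ln t)%R.
have h2 := expR_ge1Dx (- (rho * ln t))%R.
rewrite expRN -pE in h2; rewrite -pE in h1.
have p0 : (0 < t `^ rho)%R by rewrite powR_gt0.
have := ler_wpM2l (ltW p0) h2; rewrite mulfV ?gt_eqF// => h3.
rewrite [leRHS](_ : _ = (rho * ln t) ^+ 2 + (t `^ rho * (rho * ln t)) ^+ 2)%R; last by ring.
move: (rho * ln t)%R (t `^ rho)%R h1 h3 p0 => z p h1 h3 p0.
have [p1|p1] := leP p 1%R.
  rewrite (@le_trans _ _ (z ^+ 2)%R)// ?lerDl ?sqr_ge0//.
  by nra.
rewrite (@le_trans _ _ ((p * z) ^+ 2)%R)// ?lerDr ?sqr_ge0//.
by nra.
Qed.

(** Reduces to the logarithmic integrals with exponents 0 and 2 rho = alpha - 1, both above -1 since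
    alpha > 0. *)
Lemma integral_01_kernel_gamma (alpha c rho : R) (K : R -> \bar R) :
  (0 < alpha)%R -> (alpha < 2)%R -> (0 < c)%R -> (alpha - 1 = rho + rho)%R ->
  measurable_fun setT K -> (forall t, 0 <= K t) ->
  (forall t, (0 < t < 1)%R -> K t <= (c * (1 - t) `^ (- alpha - 1))%:E) ->
  \int[mu]_(t in `]0%R, 1%R[) (((1 - t `^ rho) * (1 - t `^ (alpha - 1 - rho)))%:E * K t) < +oo.
Proof.
move=> alpha0 alpha2 c0 hrho mK K0 Kc; have ml2 := @measurable_ln_sqr R.
rewrite hrho addrK; under eq_integral do rewrite -expr2.
apply: (@ge0_le_integral_lty _ _ _ (fun t => (rho ^+ 2)%:E *
   ((t `^ 0 * ln t ^+ 2)%:E * K t + (t `^ (rho + rho) * ln t ^+ 2)%:E * K t))).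
- exact: measurable_itv.
- by solve_meas.
- by solve_meas.
- by move=> t _; rewrite mule_ge0// lee_fin sqr_ge0.
- move=> t /=; rewrite in_itv/= => /andP[t0 t1].
  rewrite -ge0_muleDl; try by solve_ge0.
  by rewrite muleA; apply: lee_wpmul2r => //; rewrite -EFinD -EFinM lee_fin sqr_onem_powR_le.
- have p0 s x : 0 <= (x `^ s * ln x ^+ 2)%:E * K x.
    by solve_ge0; exact: K0.
  apply: integralZl_lty.
  + exact: measurable_itv.
  + by solve_meas.
  + by move=> x; rewrite adde_ge0.
  + by rewrite sqr_ge0.
  apply: integralD_lty => //; try by solve_meas.
    by apply: (@integral_01_kernel_ln _ alpha c) => //; lra.
  by apply: (@integral_01_kernel_ln _ alpha c) => //; lra.
Qed.

(** On (0, 1) the kernel is at most c, so s > -1 suffices; beyond 1 the integrand is at most c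
    t^(s-alpha-1), so s < alpha suffices. *)
Lemma integral_Rpos_kernel_powR (alpha c s : R) (K : R -> \bar R) :
  (0 < alpha)%R -> (0 < c)%R ->
  measurable_fun setT K -> (forall t, 0 <= K t) ->
  (forall t, (0 < t)%R -> K t <= (c * (1 + t) `^ (- alpha - 1))%:E) ->
  (-1 < s)%R -> (s < alpha)%R ->
  \int[mu]_(t in Rpos) ((t `^ s)%:E * K t) < +oo.
Proof.
move=> alpha0 c0 mK K0 Kc s1 sa.
have p0 t : 0 <= (t `^ s)%:E * K t by rewrite mule_ge0// lee_fin powR_ge0.
rewrite integral_Rpos_split//; last by solve_meas.
have Kle t (d : R) : (0 < t)%R -> ((1 + t) `^ (- alpha - 1) <= d)%R ->
    (t `^ s)%:E * K t <= c%:E * (t `^ s * d)%:E.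
  move=> t0 td; apply: (@le_trans _ _ ((t `^ s)%:E * (c * d)%:E)).
    apply: lee_wpmul2l; first by rewrite lee_fin powR_ge0.
    by apply: (le_trans (Kc _ t0)); rewrite lee_fin ler_wpM2l// ltW.
  by rewrite -!EFinM mulrCA.
have N t : ((1 + t) `^ (- alpha - 1) = ((1 + t) `^ (alpha + 1))^-1)%R.
  by rewrite -powRN opprD.
apply: lte_add_pinfty.
  apply: (@ge0_le_integral_lty _ _ _ (fun t => c%:E * (t `^ s)%:E)).
  - exact: measurable_itv.
  - by solve_meas.
  - by solve_meas.
  - by move=> t _.
  - move=> t /=; rewrite in_itv/= => /andP[t0 t1].
    rewrite -[X in (_ <= c%:E * X%:E)]mulr1; apply: Kle => //.
    rewrite N invf_le1 ?powR_gt0 ?addr_gt0//.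
    rewrite -[leLHS](powRr0 (1 + t)%R).
    by apply: ler_powR; rewrite ?lerDl ?addr_ge0// ltW.
  apply: integralZl_lty => //; first by solve_meas.
  - by move=> x; rewrite lee_fin powR_ge0.
  - exact: ltW.
  - exact: integral_powR_01.
apply: (@ge0_le_integral_lty _ _ _ (fun t => c%:E * (t `^ (s - alpha - 1))%:E)).
- exact: measurable_itv.
- by solve_meas.
- by solve_meas.
- by move=> t _.
- move=> t /=; rewrite in_itv/= andbT => t1.
  have t0 : (0 < t)%R by exact: lt_le_trans t1.
  have -> : (t `^ (s - alpha - 1) = t `^ s * t `^ (- alpha - 1))%R.
    by rewrite -powRD ?(gt_eqF t0) ?implybT// addrA.
  apply: Kle => //; rewrite N.
  have -> : (- alpha - 1 = - (alpha + 1))%R by rewrite opprD.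
  rewrite powRN lef_pV2 ?posrE ?powR_gt0 ?addr_gt0//.
  by apply: ge0_ler_powR; rewrite ?nnegrE ?lerDr ?addr_ge0 ?(ltW t0) ?(ltW alpha0).
apply: integralZl_lty => //; first by solve_meas.
- by move=> x; rewrite lee_fin powR_ge0.
- exact: ltW.
- by apply: integral_powR_1y; lra.
Qed.

Lemma integral_Rpos_kernel_ln (alpha c s : R) (K : R -> \bar R) :
  (0 < alpha)%R -> (0 < c)%R ->
  measurable_fun setT K -> (forall t, 0 <= K t) ->
  (forall t, (0 < t)%R -> K t <= (c * (1 + t) `^ (- alpha - 1))%:E) ->
  (-1 < s)%R -> (s < alpha)%R ->
  \int[mu]_(t in Rpos) ((t `^ s * ln t ^+ 2)%:E * K t) < +oo.
Proof.
move=> alpha0 c0 mK K0 Kc s1 sa; have ml2 := @measurable_ln_sqr R.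
(* This e keeps both exponents s + 2e and s - 2e strictly between -1 and alpha. *)
pose e := Num.min ((s + 1) / 4)%R ((alpha - s) / 4)%R.
have e0 : (0 < e)%R by rewrite lt_min; apply/andP; split; lra.
have e1 : (e <= (s + 1) / 4)%R by rewrite ge_min lexx.
have e2 : (e <= (alpha - s) / 4)%R by rewrite ge_min lexx orbT.
have p0 u t : 0 <= (t `^ u)%:E * K t by rewrite mule_ge0// lee_fin powR_ge0.
have C0 : (0 <= 2 / e ^+ 2)%R by rewrite divr_ge0// sqr_ge0.
apply: (@ge0_le_integral_lty _ _ _ (fun t => (2 / e ^+ 2)%:E *
   ((t `^ (s + 2 * e))%:E * K t + (t `^ (s - 2 * e))%:E * K t))) => //.
- by solve_meas.
- by solve_meas.
- by solve_ge0; exact: K0.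
- move=> t; rewrite RposE => t0.
  rewrite -ge0_muleDl ?lee_fin ?powR_ge0//.
  rewrite muleA; apply: lee_wpmul2r => //; rewrite -EFinD -EFinM lee_fin.
  rewrite !powRD ?(gt_eqF t0) ?implybT// -mulrDr [leRHS]mulrCA ler_wpM2l ?powR_ge0//.
  exact: sqr_ln_le_powR.
- apply: integralZl_lty => //; first by solve_meas.
    by move=> x; rewrite adde_ge0.
  apply: integralD_lty => //; try by solve_meas.
    by apply: (@integral_Rpos_kernel_powR alpha c) => //; lra.
  by apply: (@integral_Rpos_kernel_powR alpha c) => //; lra.
Qed.

End finite_kernel_integrals.

(** * Truncated ground states *)

Section cutoff.
Context {R : realType}.
Notation mu := (@lebesgue_measure R).
Notation Rpos := (@Rpos R).
Implicit Types (n : nat) (x t : R).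

(** The case x = 0 overrides the convention ln 0 = 0, which would give the value 1 at the origin. *)
Definition cutoff n x : R :=
  if x == 0 then 0 else Num.max 0 (1 - `|ln `|x| | / n.+1%:R).

Lemma cutoffN n x : cutoff n (- x) = cutoff n x.
Proof. by rewrite /cutoff oppr_eq0 normrN. Qed.

Lemma cutoff_ge0 n x : 0 <= cutoff n x.
Proof. by rewrite /cutoff; case: ifPn => // _; rewrite le_max lexx. Qed.

Lemma measurable_cutoff n : measurable_fun setT (cutoff n).
Proof.
apply: measurable_fun_ifT => //.
  exact: measurable_fun_eqr.
apply: measurable_maxr; first exact: measurable_cst.
apply: measurable_funB; first exact: measurable_cst.
apply: measurable_funM; last exact: measurable_cst.
apply: measurableT_comp; first exact: normr_measurable.
by apply: measurableT_comp; [exact: measurable_ln|exact: normr_measurable].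
Qed.

Lemma cutoff_le n m x : (n <= m)%N -> cutoff n x <= cutoff m x.
Proof.
move=> nm; rewrite /cutoff; case: ifPn => // _.
rewrite ge_max le_max lexx/= le_max; apply/orP; right.
by rewrite lerB// ler_wpM2l// lef_pV2 ?posrE// ler_nat.
Qed.

Lemma cutoff_gt0 x : x != 0 -> exists n, 0 < cutoff n x.
Proof.
move=> x0; exists (Num.truncn `|ln `|x| |); rewrite /cutoff (negbTE x0) lt_max; apply/orP; right.
by rewrite subr_gt0 ltr_pdivrMr// mul1r truncnS_gt.
Qed.

Lemma cutoff_supp n x : cutoff n x != 0 -> expR (- n.+1%:R) <= `|x| <= expR n.+1%:R.
Proof.
rewrite /cutoff; case: (eqVneq x 0) => [_|x0]; first by rewrite eqxx.
have x0' : 0 < `|x| by rewrite normr_gt0.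
have [h|h _] := leP (1 - `|ln `|x| | / n.+1%:R) 0; first by rewrite eqxx.
move: h; rewrite subr_gt0 ltr_pdivrMr// mul1r => /ltW; rewrite ler_norml => /andP[h1 h2].
by rewrite -[X in _ <= X <= _](@lnK _ `|x|) ?posrE// !ler_expR h1.
Qed.

(** In the coordinate ln x the cutoff is a tent of slope 1/(n+1), and a dilation by t is a
    translation by ln t. *)
Lemma cutoff_lipschitz n x t : 0 < x -> 0 < t ->
  (cutoff n x - cutoff n (t * x)) ^+ 2 <= (ln t / n.+1%:R) ^+ 2.
Proof.
move=> x0 t0; have tx0 : 0 < t * x by rewrite mulr_gt0.
rewrite -ler_sqrt ?sqr_ge0// !sqrtr_sqr /cutoff !gt_eqF//.
rewrite (gtr0_norm x0) (gtr0_norm tx0) lnM ?posrE//.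
rewrite [in leRHS]normrM normfV [in leRHS](@gtr0_norm _ n.+1%:R)//.
have : `|(`|ln x| - `|ln t + ln x|)| <= `|ln t|.
  apply: le_trans (ler_dist_dist _ _) _.
  by rewrite opprD addrCA subrr addr0 normrN.
have N0 : 0 < n.+1%:R^-1 :> R by rewrite invr_gt0.
move: (n.+1%:R^-1) N0 => N N0.
move: (`|ln x|) (`|ln t + ln x|) (`|ln t|) => a b l abl.
have {}abl : `|a * N - b * N| <= l * N by rewrite -mulrBl normrM (gtr0_norm N0) ler_wpM2r// ltW.
move: (a * N) (b * N) (l * N) abl => {}a {}b {}l; rewrite !ler_norml => /andP[h1 h2].
by rewrite /Num.max; case: ltP => ?; case: ltP => ?; apply/andP; split; lra.
Qed.

(** For N = n+1, the indicator of an interval containing the positive part of the support of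
    [cutoff n]; its Haar measure is 2N. *)
Definition window (N x : R) : R := if (expR (- N) <= x) && (x <= expR N) then 1 else 0.

Lemma measurable_window N : measurable_fun setT (window N).
Proof.
apply: measurable_fun_ifT; [|exact: measurable_cst|exact: measurable_cst].
apply: measurable_and; apply: measurable_fun_ler; solve_meas.
Qed.

Lemma wint_window N : 0 < N -> wint 1 (window N) = (2 * N)%:E.
Proof.
move=> N0.
have e0 : 0 < expR (- N) :> R by rewrite expR_gt0.
transitivity (\int[mu]_(x in `[expR (- N), expR N]) (x^-1)%:E)%E.
  rewrite /wint integral_mkcond [RHS]integral_mkcond; apply: eq_integral => x _.
  rewrite !patchE /window.
  have -> : (x \in Rpos) = (0 < x) by apply/idP/idP; rewrite inE RposE.
  have -> : (x \in `[expR (- N), expR N]%classic) = (expR (- N) <= x) && (x <= expR N).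
    by apply/idP/idP; rewrite inE /= in_itv.
  case: (ltP 0 x) => x0.
    by case: ifPn => _; rewrite -EFinM ?mulr0 ?mulr1// powR_inv1// ltW.
  by rewrite leNgt (le_lt_trans x0 e0).
rewrite integral_inv// ?ltr_expR ?gtrN//.
by rewrite !expRK opprK mulr2n mulrDl !mul1r.
Qed.

(** With N = n+1, the squared difference is at most (ln t / N)^2 and vanishes unless x or t x lies
    in the window. Each of these two sets has Haar measure 2N, hence the constant 4/N. *)
Lemma wint_cutoff n t : 0 < t ->
  (wint 1 (fun x => (cutoff n x - cutoff n (t * x)) ^+ 2)%R <= (4 / n.+1%:R * ln t ^+ 2)%:E)%E.
Proof.
move=> t0; set N : R := n.+1%:R; have N0 : 0 < N by [].
have mw := measurable_window N; have mc := measurable_cutoff n.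
have w0 x : 0 <= window N x by rewrite /window; case: ifPn.
apply: (@le_trans _ _ (wint 1 (fun x => (ln t / N) ^+ 2 * (window N x + window N (t * x)))%R)).
  apply: ge0_le_integral => //.
  - by move=> x _; solve_ge0.
  - by apply: measurable_funTS; solve_meas.
  - by apply: measurable_funTS; solve_meas.
  move=> x; rewrite RposE => x0; rewrite -!EFinM lee_fin ler_wpM2l ?powR_ge0//.
  have supp y : 0 < y -> cutoff n y != 0 -> window N y = 1.
    by move=> y0 /cutoff_supp; rewrite gtr0_norm// /window => ->.
  have [cx|/(supp _ x0) wx] := eqVneq (cutoff n x) 0.
    have [ctx|/(supp _ (mulr_gt0 t0 x0)) wtx] := eqVneq (cutoff n (t * x)) 0.
      by rewrite cx ctx subrr expr0n/= mulr_ge0 ?sqr_ge0 ?addr_ge0.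
    by rewrite (le_trans (cutoff_lipschitz n x0 t0))// wtx ler_peMr ?sqr_ge0// lerDr.
  by rewrite (le_trans (cutoff_lipschitz n x0 t0))// wx ler_peMr ?sqr_ge0// lerDl.
rewrite wintZ ?sqr_ge0//; last 2 first.
- by solve_meas.
- by move=> x; rewrite addr_ge0.
rewrite wintD//; last by solve_meas.
rewrite (@wint_dilation _ 1 t (window N))// subrr powRr0 mul1e wint_window// -EFinD -EFinM lee_fin.
by rewrite le_eqVlt; apply/orP; left; apply/eqP; field; rewrite gt_eqF.
Qed.

End cutoff.

Section truncated_ground_state.
Context {R : realType}.
Notation mu := (@lebesgue_measure R).
Notation Rpos := (@Rpos R).
Implicit Types (n : nat) (x t r rho : R).

Definition truncated_ground_state rho r n x : R :=
  (if 0 < x then 1 else r) * `|x| `^ rho * cutoff n x.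

Lemma continuous_near_eq (f g : R -> R) x : (\forall z \near x, f z = g z) ->
  {for x, continuous g} -> {for x, continuous f}.
Proof.
move=> fg cg; have fgx : f x = g x by exact: nbhs_singleton fg.
rewrite /prop_for /continuous_at fgx; apply: cvg_trans cg.
by apply: near_eq_cvg; near=> z; apply/esym; near: z.
Unshelve. all: by end_near. Qed.

Lemma continuous_truncated_ground_state rho r n :
  continuous (truncated_ground_state rho r n).
Proof.
move=> x; have [->|x0] := eqVneq x 0.
  (* Near the origin the cutoff vanishes, which also removes any singularity of |x|^rho. *)
  apply: (@continuous_near_eq _ (cst 0)); last exact: cst_continuous.
  near=> z.
  have zN : `|z| < expR (- n.+1%:R).
    rewrite ltr_norml; apply/andP; split; near: z.
      by apply: lt_nbhsr; rewrite oppr_lt0 expR_gt0.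
    by apply: lt_nbhsl; rewrite expR_gt0.
  rewrite /truncated_ground_state (_ : cutoff n z = 0) ?mulr0//.
  apply/eqP; apply/negPn/negP => /cutoff_supp /andP[+ _].
  by rewrite leNgt zN.
(* The sign of z is locally constant away from 0, so the function agrees near x with [g 1] or
   [g r]. *)
pose g (s : R) (z : R) := s * `|z| `^ rho * Num.max 0 (1 - `|ln `|z| | / n.+1%:R).
have nc : {for x, continuous (fun z : R => `|z|)} by exact: (@norm_continuous _ R^o).
have x0' : 0 < `|x| by rewrite normr_gt0.
have cg s : {for x, continuous (g s)}.
  apply: (@continuousM R _ (fun z => s * `|z| `^ rho)
    (fun z => Num.max 0 (1 - `|ln `|z| | / n.+1%:R))).
    apply: (@continuousM R _ (cst s) (fun z => `|z| `^ rho)); first exact: cst_continuous.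
    by apply: (@continuous_comp _ _ _ (fun z : R => `|z|) (fun y : R => y `^ rho)) => //;
      exact: continuous_powR.
  apply: (@continuous_max R _ (cst 0) (fun z : R => 1 - `|ln `|z| | / n.+1%:R));
    first exact: cst_continuous.
  apply: cvgB; first exact: cvg_cst.
  apply: (@continuousM R _ (fun z => `|ln `|z| |) (cst (n.+1%:R^-1))); last exact: cst_continuous.
  apply: (@continuous_comp _ _ _ (fun z : R => ln `|z|) (fun z : R => `|z|));
    last exact: (@norm_continuous _ R^o).
  by apply: (@continuous_comp _ _ _ (fun z : R => `|z|) (@ln R)) => //; exact: continuous_ln.
have [xp|xn] := ltP 0 x.
  apply: continuous_near_eq (cg 1); near=> z.
  have z0 : 0 < z by near: z; exact: lt_nbhsr.
  by rewrite /truncated_ground_state z0 /cutoff gt_eqF.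
have {}xn : x < 0 by rewrite lt_neqAle x0.
apply: continuous_near_eq (cg r); near=> z.
have z0 : z < 0 by near: z; exact: lt_nbhsl.
by rewrite /truncated_ground_state ltNge (ltW z0) /cutoff lt_eqF.
Unshelve. all: by end_near. Qed.

(** The support lies in the closed set exp(-(n+1)) <= |x| <= exp(n+1): the upper bound gives
    compactness, the lower one keeps the origin out. *)
Lemma Cc_truncated_ground_state rho r n : Cc_Rstar (truncated_ground_state rho r n).
Proof.
rewrite /Cc_Rstar; set S := [set x | truncated_ground_state rho r n x != 0].
have cS : closure S `<=` [set x | expR (- n.+1%:R) <= `|x|] `&` [set x | `|x| <= expR n.+1%:R].
  have cl : closed ([set x : R | expR (- n.+1%:R) <= `|x|] `&` [set x | `|x| <= expR n.+1%:R]).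
    apply: closedI.
      by apply: (@closed_comp _ _ (fun x : R => `|x|) [set x | expR (- n.+1%:R) <= x]);
        [move=> x _; exact: (@norm_continuous _ R^o)|exact: closed_ge].
    by apply: (@closed_comp _ _ (fun x : R => `|x|) [set x | x <= expR n.+1%:R]);
      [move=> x _; exact: (@norm_continuous _ R^o)|exact: closed_le].
  move/closure_id : cl => ->; apply: closure_subset => x; rewrite /S/= => h.
  have /cutoff_supp/andP[] // : cutoff n x != 0.
  by apply: contraNneq h => h; rewrite /truncated_ground_state h mulr0.
split.
- exact: continuous_truncated_ground_state.
- apply: (@subclosed_compact _ _ `[- expR n.+1%:R, expR n.+1%:R]).
  + exact: closed_closure.
  + exact: segment_compact.
  + by move=> x /cS[_ /=]; rewrite ler_norml in_itv.
- move=> x /cS[/= h _]; rewrite /Rstar/= -normr_gt0; apply: lt_le_trans h.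
  exact: expR_gt0.
Qed.

Local Open Scope ereal_scope.

(** The choice of rho enters here: x^(-alpha) x^(2 rho) = 1/x turns the weighted integral into a
    Haar integral of cutoff differences. *)
Lemma scaled_wint_cutoff (alpha rho c t : R) n (f : R -> R) : (alpha - 1 = rho + rho)%R ->
  (0 <= c)%R -> (0 < t)%R ->
  (forall x, (0 < x)%R -> f x = c * x `^ (rho + rho) * (cutoff n x - cutoff n (t * x)) ^+ 2)%R ->
  wint alpha f <= (4 / n.+1%:R)%:E * (c * ln t ^+ 2)%:E.
Proof.
move=> hrho c0 t0 fE; have mc := @measurable_cutoff R n.
have mg : measurable_fun setT (fun x => (cutoff n x - cutoff n (t * x)) ^+ 2)%R by solve_meas.
rewrite (_ : wint alpha f = c%:E * wint 1 (fun x => (cutoff n x - cutoff n (t * x)) ^+ 2)%R).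
  rewrite -EFinM mulrCA EFinM; apply: lee_wpmul2l; first by rewrite lee_fin.
  exact: wint_cutoff.
rewrite -wintZ//; last by move=> x; exact: sqr_ge0.
apply: eq_integral_Rpos => x x0; rewrite fE// -!EFinM; congr EFin.
have -> : (x `^ (- 1) = x `^ (- alpha) * x `^ (rho + rho))%R.
  by rewrite -powRD ?(gt_eqF x0) ?implybT// -hrho; congr (_ `^ _)%R; ring.
by ring.
Qed.

Variables (alpha rho r : R) (K : R -> R -> \bar R).
Hypotheses (hrho : (alpha - 1 = rho + rho)%R) (hK : homogeneous_kernel alpha K) (r0 : (0 < r)%R).

Let measurable_K1 : measurable_fun setT (fun t => K 1%R t).
Proof. by have [mK _ _] := hK; apply: (measurable_fun_comp2 (F := K)) => //; solve_meas. Qed.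

Let measurable_lnK : measurable_fun setT (fun t => (t `^ rho * ln t ^+ 2)%:E * K 1%R t).
Proof. by have ml2 := @measurable_ln_sqr R; solve_meas. Qed.

Let lnK_ge0 t : 0 <= (t `^ rho * ln t ^+ 2)%:E * K 1%R t.
Proof. by have [_ K0 _] := hK; solve_ge0; exact: K0. Qed.

(** Here v(x) - v(t x) / t^rho is c x^rho times a difference of cutoffs, because x^rho itself
    contributes nothing to the remainder. The constant c stands for 1 on the positive and r on the
    negative half-line. *)
Lemma diagonal_remainder_le n (c : R) (v : R -> R) : measurable_fun setT v -> (0 <= c)%R ->
  (forall x, (0 < x)%R -> v x = c * x `^ rho * cutoff n x)%R ->
  \int[mu]_(t in `]0%R, 1%R[)
      (K 1%R t * wint alpha (fun x => t `^ rho * (v x - v (t * x) / t `^ rho) ^+ 2)%R) <=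
  (4 / n.+1%:R)%:E * ((c ^+ 2)%:E *
    \int[mu]_(t in `]0%R, 1%R[) ((t `^ rho * ln t ^+ 2)%:E * K 1%R t)).
Proof.
move=> mv c0 vE; have [mK K0 _] := hK.
have N0 : (0 <= 4 / n.+1%:R :> R)%R by rewrite divr_ge0.
rewrite muleA -EFinM -ge0_integralZl; try by [exact: measurable_itv|
  exact: measurable_funTS|move=> *; exact: lnK_ge0|
  rewrite lee_fin mulr_ge0// sqr_ge0].
apply: ge0_le_integral => //.
- by move=> t _; rewrite mule_ge0//; apply: wint_ge0; solve_ge0.
- apply: measurable_funTS; exact: measurable_diagonal_remainder.
- by apply: measurable_funTS; have ml2 := @measurable_ln_sqr R; solve_meas.
move=> t /=; rewrite in_itv/= => /andP[t0 t1].
rewrite muleC muleA; apply: lee_wpmul2r => //.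
rewrite -EFinM -mulrA EFinM (mulrA (c ^+ 2)%R).
apply: (@scaled_wint_cutoff alpha rho (c ^+ 2 * t `^ rho)%R t) => //.
  by rewrite mulr_ge0 ?sqr_ge0 ?powR_ge0.
move=> x x0; rewrite vE// vE ?mulr_gt0// powRM ?ltW//.
rewrite powRD ?(gt_eqF x0) ?implybT//.
by field; rewrite gt_eqF// powR_gt0.
Qed.

(** Dividing v by x^rho and w by r y^rho leaves the bare cutoffs, whose difference is again
    controlled by the logarithm of the ratio y/x. *)
Lemma offdiagonal_remainder_le n (v w : R -> R) : measurable_fun setT v -> measurable_fun setT w ->
  (forall x, (0 < x)%R -> v x = x `^ rho * cutoff n x)%R ->
  (forall x, (0 < x)%R -> w x = r * x `^ rho * cutoff n x)%R ->
  kint K (fun x y =>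
    r * (x `^ rho * y `^ rho) * (v x * x `^ (- rho) - r^-1 * (w y * y `^ (- rho))) ^+ 2)%R <=
  (4 / n.+1%:R)%:E * (r%:E *
    \int[mu]_(t in Rpos) ((t `^ rho * ln t ^+ 2)%:E * K 1%R t)).
Proof.
move=> mv mw vE wE; have [mK K0 _] := hK; have mc := @measurable_cutoff R n.
have N0 : (0 <= 4 / n.+1%:R :> R)%R by rewrite divr_ge0.
pose f x y : R := (r * (x `^ rho * y `^ rho) * (cutoff n x - cutoff n y) ^+ 2)%R.
have mf : measurable_fun setT (fun z : R * R => f z.1 z.2) by rewrite /f; solve_meas.
have f0 x y : (0 <= f x y)%R by rewrite /f; solve_ge0.
rewrite (@eq_kint _ _ _ f); last first.
  move=> x y x0 y0; rewrite /f vE// wE//; congr (_ * _ ^+ 2)%R.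
  by rewrite !powRN; field; rewrite !gt_eqF ?powR_gt0.
rewrite (kint_polar hK mf f0).
rewrite muleA -EFinM -ge0_integralZl; try by [|
  exact: measurable_funTS|move=> *; exact: lnK_ge0|
  rewrite lee_fin mulr_ge0// ltW].
apply: ge0_le_integral => //.
- by move=> t _; rewrite mule_ge0//; apply: wint_ge0.
- apply: measurable_funTS; apply: emeasurable_funM => //.
  apply: (@measurable_fun_integral_Rpos _ (fun t x => (x `^ (- alpha))%:E * (f x (t * x)%R)%:E)).
    by rewrite /f; solve_meas.
  by solve_ge0; exact: f0.
- by apply: measurable_funTS; solve_meas.
move=> t; rewrite RposE => t0.
rewrite muleC muleA; apply: lee_wpmul2r => //.
rewrite -EFinM -mulrA EFinM (mulrA r).
apply: (@scaled_wint_cutoff alpha rho (r * t `^ rho)%R t) => //.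
  by rewrite mulr_ge0 ?(ltW r0) ?powR_ge0.
move=> x x0; rewrite /f powRM ?ltW// powRD ?(gt_eqF x0) ?implybT//.
by ring.
Qed.

End truncated_ground_state.

(** * The energy on the whole line *)

Section compact_support.
Context {R : realType}.
Notation mu := (@lebesgue_measure R).
Notation Rpos := (@Rpos R).
Local Open Scope ereal_scope.
Implicit Types (u W : R -> R).

Lemma open_Rstar : open (@Rstar R).
Proof.
have -> : @Rstar R = ~` [set 0%R].
  by apply/seteqP; split => x /=; rewrite /Rstar/=; move/eqP.
by apply: closed_openC; exact: closed_eq.
Qed.

Lemma Cc_Rstar_at0 u : Cc_Rstar u -> u 0%R = 0%R.
Proof.
move=> [_ _ h]; apply/eqP; apply/negPn/negP => u0.
by have /h := @subset_closure _ [set x | u x != 0%R] 0%R u0; rewrite /Rstar/= eqxx.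
Qed.

Lemma Cc_Rstar_bounded u : Cc_Rstar u -> exists2 M : R, (0 <= M)%R & forall x, (u x ^+ 2 <= M)%R.
Proof.
move=> [cu cK _]; set K := closure _ in cK.
have cuK : compact (u @` K).
  by apply: continuous_compact => //; exact: continuous_subspaceT.
have [M [Mreal HM]] := compact_bounded cuK.
have hM := HM (`|M| + 1)%R; rewrite /= in hM.
exists ((`|M| + 1) ^+ 2)%R; first exact: sqr_ge0.
move=> x; have [->|ux] := eqVneq (u x) 0%R; first by rewrite expr0n/= sqr_ge0.
have Kx : K x by apply: subset_closure.
rewrite -(ger0_norm (sqr_ge0 (u x))) normrX lerXn2r ?nnegrE ?addr_ge0//.
apply: hM; last by exists x.
by rewrite ltr_pwDr// ler_norm.
Qed.

Lemma Cc_Rstar_measurable u : Cc_Rstar u -> measurable_fun setT u.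
Proof. by move=> [cu _ _]; exact: continuous_measurable_fun. Qed.

(** The square of u is bounded and vanishes off a compact subset of the punctured line, on which W
    is integrable. *)
Lemma Cc_Rstar_integrable u W : locally_integrable (@Rstar R) W -> Cc_Rstar u ->
  mu.-integrable setT (fun x => (u x ^+ 2 * W x)%:E).
Proof.
move=> [mW _ lW] uC; have [cu cK KR] := uC.
have mu_ := Cc_Rstar_measurable uC; have [M M0 HM] := Cc_Rstar_bounded uC.
pose K := closure [set x | u x != 0%R].
have mK : measurable K by exact: compact_measurable.
have mR : measurable (@Rstar R) by exact: open_measurable open_Rstar.
(* W is known to be measurable only off the origin; resetting it to 0 there leaves the product
   unchanged because u(0) = 0. *)
have mg : measurable_fun setT (W \_ (@Rstar R)) by apply/(measurable_restrictT _ mR).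
have mf : measurable_fun setT (fun x => u x ^+ 2 * W x)%R.
  apply: (eq_measurable_fun (fun x => u x ^+ 2 * (W \_ (@Rstar R)) x)%R); last by solve_meas.
  move=> x _; rewrite patchE; case: ifPn => //; rewrite notin_setE /Rstar/= => /negP/negPn/eqP ->.
  by rewrite (Cc_Rstar_at0 uC) expr0n/= !mul0r.
apply/integrableP; split; first exact/measurable_EFinP.
have mWK : measurable_fun K W by apply: measurable_funS mW.
apply: (@le_lt_trans _ _ (M%:E * \int[mu]_(x in K) `|W x|%:E)); last first.
  by rewrite lte_mul_pinfty ?lee_fin//; exact: lW.
rewrite -ge0_integralZl//; last first.
  by apply/measurable_EFinP; apply: measurableT_comp mWK; exact: normr_measurable.
rewrite [leRHS]integral_mkcond; apply: ge0_le_integral => //.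
- by apply: measurableT_comp => //; exact/measurable_EFinP.
- apply/(measurable_restrictT _ mK).
  apply: measurable_funeM.
  by apply/measurable_EFinP; apply: measurableT_comp mWK; exact: normr_measurable.
move=> x _; rewrite patchE; case: ifPn => xK.
  by rewrite abse_EFin normrM -EFinM lee_fin ler_wpM2r// ger0_norm ?sqr_ge0.
have -> : u x = 0%R.
  apply/eqP; apply/negPn/negP => ux; move/negP: xK; apply; rewrite inE.
  exact: subset_closure.
by rewrite expr0n mul0r abse_EFin normr0.
Qed.

Lemma locally_integrable_powR (a : R) : locally_integrable (@Rstar R) (fun x => `|x| `^ a)%R.
Proof.
split; [| exact: open_Rstar|].
  apply: measurable_funTS; apply: (measurableT_comp (measurable_powR _)).
  exact: normr_measurable.
move=> K KR cK.
have : mu.-integrable K (EFin \o (fun x => `|x| `^ a)%R).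
  apply: continuous_compact_integrable => //.
  apply: continuous_in_subspaceT => x /[!inE] /KR; rewrite /Rstar/= => x0.
  apply: (@continuous_comp _ _ _ (fun z : R => `|z|)%R (fun y : R => y `^ a)%R).
    exact: (@norm_continuous _ R^o).
  by apply: continuous_powR; rewrite normr_gt0.
by move=> /integrableP[].
Qed.

Lemma locally_integrable_le (f g : R -> R) (D : set R) : measurable_fun D f ->
  (forall x, `|f x| <= g x)%R -> locally_integrable D g -> locally_integrable D f.
Proof.
move=> mf fg [mg oD lg]; split => // K KD cK; apply: le_lt_trans (lg K KD cK).
have mK := compact_measurable cK; have mD := open_measurable oD.
apply: ge0_le_integral => //.
- by apply/measurable_EFinP; apply: measurableT_comp;
    [exact: normr_measurable|exact: measurable_funS mf].
- by apply/measurable_EFinP; apply: measurableT_comp;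
    [exact: normr_measurable|exact: measurable_funS mg].
by move=> x _; rewrite lee_fin (le_trans (fg x))// ler_norm.
Qed.

End compact_support.

Section energy_split.
Context {R : realType} (alpha : R) (k : R -> R -> \bar R).
Notation mu := (@lebesgue_measure R).
Notation Rpos := (@Rpos R).
Local Open Scope ereal_scope.
Hypotheses (hk : homogeneous_kernel alpha k) (ksym : forall x y, k x y = k y x).
Implicit Types (u : R -> R).

(** [kernel_mm] and [kernel_pm] fold the negative-negative and the positive-negative quadrant onto
    the positive one, where the half-line identities apply. *)
Definition kernel_mm (x y : R) : \bar R := k (- x)%R (- y)%R.
Definition kernel_pm (x y : R) : \bar R := k x (- y)%R.

Lemma homogeneous_mm : homogeneous_kernel alpha kernel_mm.
Proof.
have [mk k0 khom] := hk; split => [|x y|x y t t0].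
- by apply: (measurable_fun_comp2 mk); apply: measurable_funN; solve_meas.
- exact: k0.
- by rewrite /kernel_mm -!mulrN khom.
Qed.

Lemma homogeneous_pm : homogeneous_kernel alpha kernel_pm.
Proof.
have [mk k0 khom] := hk; split => [|x y|x y t t0].
- by apply: (measurable_fun_comp2 mk); [solve_meas|apply: measurable_funN; solve_meas].
- exact: k0.
- by rewrite /kernel_pm -!mulrN khom.
Qed.

(** The four quadrants of the plane; symmetry of k makes the two mixed ones equal. *)
Lemma energy_split u : measurable_fun setT u ->
  energy k u = (2^-1)%:E *
    ((kint k (fun x y => (u x - u y) ^+ 2)%R +
      kint kernel_mm (fun x y => (u (- x) - u (- y)) ^+ 2)%R) +
     (kint kernel_pm (fun x y => (u x - u (- y)) ^+ 2)%R +
      kint kernel_pm (fun x y => (u x - u (- y)) ^+ 2)%R)).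
Proof.
move=> mu_; have [mk k0 _] := hk.
pose F x y := ((u x - u y) ^+ 2)%:E * k x y.
have Fsym x y : F x y = F y x by rewrite /F -opprB sqrrN ksym.
have F0 x y : 0 <= F x y by rewrite /F; solve_ge0; exact: k0.
have mF : measurable_fun setT (fun z : R * R => F z.1 z.2) by rewrite /F; solve_meas.
have mN : measurable_fun setT (fun x : R => - x)%R by apply: measurable_funN; solve_meas.
have mFN : measurable_fun setT (fun z : R * R => F (- z.1)%R z.2).
  by apply: (measurable_fun_comp2 mF); solve_meas.
have mF1 : measurable_fun setT (fun y => \int[mu]_(x in Rpos) F x y).
  apply: (@measurable_fun_integral_Rpos _ (fun y x => F x y)) => //.
  by apply: (measurable_fun_comp2 mF); solve_meas.
have mF2 : measurable_fun setT (fun y => \int[mu]_(x in Rpos) F (- x)%R y).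
  apply: (@measurable_fun_integral_Rpos _ (fun y x => F (- x)%R y)) => //.
  by apply: (measurable_fun_comp2 mF); solve_meas.
have I1 y : 0 <= \int[mu]_(x in Rpos) F x y by exact: integral_ge0.
have I2 y : 0 <= \int[mu]_(x in Rpos) F (- x)%R y by exact: integral_ge0.
rewrite /energy; congr (_ * _).
transitivity (\int[mu]_y (\int[mu]_(x in Rpos) F x y + \int[mu]_(x in Rpos) F (- x)%R y)).
  apply: eq_integral => y _; apply: (@integral_Rpos_reflect _ (fun x => F x y)) => //.
  by apply: (measurable_fun_comp2 mF); solve_meas.
rewrite ge0_integralD//.
rewrite (integral_Rpos_reflect mF1 I1) (integral_Rpos_reflect mF2 I2).
have -> : \int[mu]_(y in Rpos) \int[mu]_(x in Rpos) F x y = kint k (fun x y => (u x - u y) ^+ 2)%R.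
  by apply: eq_integral_Rpos => y _; apply: eq_integral_Rpos => x _; rewrite Fsym.
have -> : \int[mu]_(y in Rpos) \int[mu]_(x in Rpos) F (- x)%R (- y)%R =
    kint kernel_mm (fun x y => (u (- x) - u (- y)) ^+ 2)%R.
  by apply: eq_integral_Rpos => y _; apply: eq_integral_Rpos => x _; rewrite Fsym.
have -> : \int[mu]_(y in Rpos) \int[mu]_(x in Rpos) F (- x)%R y =
    kint kernel_pm (fun x y => (u x - u (- y)) ^+ 2)%R.
  by apply: eq_integral_Rpos => y _; apply: eq_integral_Rpos => x _; rewrite Fsym.
have -> : \int[mu]_(y in Rpos) \int[mu]_(x in Rpos) F x (- y)%R =
    kint kernel_pm (fun x y => (u x - u (- y)) ^+ 2)%R.
  rewrite (tonelli_Rpos (f := fun y x => F x (- y)%R))//.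
  by apply: (measurable_fun_comp2 mF); solve_meas.
move: (kint k _) (kint (kernel_mm) _) (kint (kernel_pm) _) => x y z.
by rewrite (addeC z y) addeACA.
Qed.

End energy_split.

Section energy_identity.
Context {R : realType}.
Notation mu := (@lebesgue_measure R).
Notation Rpos := (@Rpos R).
Local Open Scope ereal_scope.
Implicit Types (alpha rho r : R) (k : R -> R -> \bar R) (u : R -> R).

(** The double integral of the squared difference of u/h, with weight h h k and the factor 1/2.
    Symmetry absorbs the 1/2: of each same-sign quadrant only |y| < |x| is kept, in polar form, and
    of the two mixed quadrants only one. On the negative half-line r cancels between h h and the
    square. *)
Definition hardy_remainder alpha rho r k u : \bar R :=
  \int[mu]_(t in `]0%R, 1%R[)
      (k 1%R t * wint alpha (fun x => t `^ rho * (u x - u (t * x) / t `^ rho) ^+ 2)%R) +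
  \int[mu]_(t in `]0%R, 1%R[)
      (kernel_mm k 1%R t *
       wint alpha (fun x => t `^ rho * (u (- x) - u (- (t * x)) / t `^ rho) ^+ 2)%R) +
  kint (kernel_pm k) (fun x y => r * (x `^ rho * y `^ rho) *
    (u x * x `^ (- rho) - r^-1 * (u (- y) * y `^ (- rho))) ^+ 2)%R.

Lemma hardy_remainder_ge0 alpha rho r k u : homogeneous_kernel alpha k -> (0 < r)%R ->
  0 <= hardy_remainder alpha rho r k u.
Proof.
move=> hk r0; have [_ k0 _] := hk; have [_ k0' _] := homogeneous_mm hk.
rewrite /hardy_remainder; apply: adde_ge0; [apply: adde_ge0|].
- by apply: integral_ge0 => t _; rewrite mule_ge0//; apply: wint_ge0; solve_ge0.
- by apply: integral_ge0 => t _; rewrite mule_ge0//; apply: wint_ge0; solve_ge0.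
- by apply: kint_ge0; [exact: homogeneous_pm hk|solve_ge0].
Qed.

Lemma ereal_cancel (x y : \bar R) (c d : R) : x + c%:E = y + d%:E -> x = y + (d - c)%:E.
Proof.
move=> E; rewrite EFinB addeA -E -EFinN -addeA -EFinD subrr.
by rewrite adde0.
Qed.

(** The two diagonal identities supply gamma and the off-diagonal one the rest of [C_plus] and
    [C_minus]. All these constants and the two integrals of u^2 are assumed real, so that only the
    remainder can be infinite. *)
Lemma energy_identity alpha rho r k u (g gm s sm T Tm a b : R) :
  homogeneous_kernel alpha k -> (forall x y, k x y = k y x) ->
  (alpha - 1 = rho + rho)%R -> (0 < r)%R -> measurable_fun setT u ->
  gamma_plus alpha k rho = g%:E -> gamma_minus alpha k rho = gm%:E ->
  \int[mu]_(t in Rpos) k 1%R (- t)%R = s%:E -> \int[mu]_(t in Rpos) k (-1)%R t = sm%:E ->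
  \int[mu]_(t in Rpos) ((t `^ rho)%:E * k 1%R (- t)%R) = T%:E ->
  \int[mu]_(t in Rpos) ((t `^ rho)%:E * k (-1)%R t) = Tm%:E ->
  wint alpha (fun x => u x ^+ 2)%R = a%:E -> wint alpha (fun x => u (- x) ^+ 2)%R = b%:E ->
  energy k u = hardy_remainder alpha rho r k u +
    ((g + s - r * T) * a + (gm + sm - r^-1 * Tm) * b)%:E.
Proof.
move=> hk ksym hrho r0 mu_ gE gmE sE smE TE TmE aE bE.
have mN : measurable_fun setT (fun x : R => - x)%R by apply: measurable_funN; solve_meas.
have muN : measurable_fun setT (fun x : R => u (- x)%R) by exact: (measurableT_comp mu_ mN).
have hmm := homogeneous_mm hk; have hpm := homogeneous_pm hk.
rewrite (energy_split hk ksym mu_).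
have afin : wint alpha (fun x => u x ^+ 2)%R < +oo by rewrite aE ltry.
have bfin : wint alpha (fun x => u (- x) ^+ 2)%R < +oo by rewrite bE ltry.
rewrite (diagonal_identity hk ksym hrho mu_ afin).
have mmsym x y : kernel_mm k x y = kernel_mm k y x by exact: ksym.
rewrite (diagonal_identity hmm mmsym hrho muN bfin).
rewrite -/(gamma_plus alpha k rho) -/(gamma_minus alpha k rho) gE gmE.
have := offdiagonal_identity rho hpm r0 mu_ muN.
rewrite aE bE.
(* [kernel_pm k t 1] is k(t, -1), which symmetry turns into the k(-1, t) of [C_minus]. *)
have -> : \int[mu]_(t in Rpos) kernel_pm k t 1%R = sm%:E.
  by rewrite -smE; apply: eq_integral => t _; exact: ksym.
have -> : \int[mu]_(t in Rpos) ((t `^ rho)%:E * kernel_pm k t 1%R) = Tm%:E.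
  by rewrite -TmE; apply: eq_integral => t _; rewrite [kernel_pm _ _ _]ksym.
rewrite (_ : \int[mu]_(t in Rpos) kernel_pm k 1%R t = s%:E)//.
rewrite (_ : \int[mu]_(t in Rpos) ((t `^ rho)%:E * kernel_pm k 1%R t) = T%:E)//.
rewrite -!EFinM -!EFinD => /ereal_cancel ->.
rewrite /hardy_remainder; have [_ k0 _] := hk; have [_ k0' _] := hmm.
set D1 := integral _ _ _; set D2 := integral _ _ _; set D3 := kint _ _.
have D1_ge0 : 0 <= D1.
  by apply: integral_ge0 => t _; rewrite mule_ge0//; apply: wint_ge0; solve_ge0.
have D2_ge0 : 0 <= D2.
  by apply: integral_ge0 => t _; rewrite mule_ge0//; apply: wint_ge0; solve_ge0.
have D3_ge0 : 0 <= D3 by apply: kint_ge0; [exact: hpm|solve_ge0].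
(* If one part is infinite, both sides are +oo; otherwise the claim is real algebra. *)
move: D1 D2 D3 D1_ge0 D2_ge0 D3_ge0.
move=> [d1| |] [d2| |] [d3| |]//= _ _ _; rewrite ?gt0_muley ?lte_fin//.
rewrite -!(EFinM, EFinD); congr EFin.
by field; rewrite gt_eqF.
Qed.

Lemma measurable_sign_power alpha (p q : R) :
  measurable_fun setT (fun x : R => `|x| `^ (- alpha) * (if 0 < x then p else q))%R.
Proof.
apply: measurable_funM.
  by apply: (measurableT_comp (measurable_powR _)); exact: normr_measurable.
by apply: measurable_fun_ifT => //; apply: measurable_fun_ltr; solve_meas.
Qed.

Lemma locally_integrable_sign_power alpha (p q : R) :
  locally_integrable (@Rstar R) (fun x : R => `|x| `^ (- alpha) * (if 0 < x then p else q))%R.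
Proof.
pose c := (`|p| + `|q|)%R.
(* Writing the constant c as a degenerate [if] lets [measurable_sign_power] serve the majorant
   too. *)
apply: (@locally_integrable_le _ _ (fun x : R => `|x| `^ (- alpha) * (if 0 < x then c else c))%R).
- by apply: measurable_funTS; exact: measurable_sign_power.
- move=> x; rewrite normrM (ger0_norm (powR_ge0 _ _)) ler_wpM2l ?powR_ge0//.
  by case: ifPn => _; rewrite /c ?lerDl ?lerDr normr_ge0.
split; [|exact: open_Rstar|].
  by apply: measurable_funTS; exact: measurable_sign_power.
move=> K KR cK; have [_ _ /(_ K KR cK) lK] := locally_integrable_powR (- alpha)%R.
have mK := compact_measurable cK; have c0 : (0 <= c)%R by rewrite addr_ge0.
have mn : measurable_fun K (fun x : R => `| `|x| `^ (- alpha) |%:E)%R.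
  apply: measurable_funTS; apply/measurable_EFinP.
  apply: measurableT_comp; first exact: normr_measurable.
  by apply: (measurableT_comp (measurable_powR _)); exact: normr_measurable.
rewrite (_ : integral _ _ _ = c%:E * \int[mu]_(x in K) (`| `|x| `^ (- alpha) |%R)%:E).
  by rewrite lte_mul_pinfty// lee_fin.
rewrite -ge0_integralZl//; apply: eq_integral => x _.
by rewrite if_same normrM (ger0_norm c0) mulrC EFinM.
Qed.

Lemma wint_Cc_fin alpha u : Cc_Rstar u -> exists a b : R,
  wint alpha (fun x => u x ^+ 2)%R = a%:E /\ wint alpha (fun x => u (- x) ^+ 2)%R = b%:E.
Proof.
move=> uC; have mu_ := Cc_Rstar_measurable uC.
have /integrableP[_] := Cc_Rstar_integrable (locally_integrable_powR (- alpha)%R) uC.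
have mN : measurable_fun setT (fun x : R => `|x| `^ (- alpha))%R.
  by apply: (measurableT_comp (measurable_powR _)); exact: normr_measurable.
rewrite integral_Rpos_reflect//; last by apply: measurableT_comp => //; solve_meas.
rewrite [X in X + _](_ : _ = wint alpha (fun x => u x ^+ 2)%R); last first.
  apply: eq_integral_Rpos => x x0; rewrite abse_EFin ger0_norm; last by solve_ge0.
  by rewrite gtr0_norm// mulrC EFinM.
rewrite [X in _ + X](_ : _ = wint alpha (fun x => u (- x) ^+ 2)%R); last first.
  apply: eq_integral_Rpos => x x0; rewrite abse_EFin ger0_norm; last by solve_ge0.
  by rewrite normrN gtr0_norm// mulrC EFinM.
have : 0 <= wint alpha (fun x => u x ^+ 2)%R by apply: wint_ge0; solve_ge0.
have : 0 <= wint alpha (fun x => u (- x) ^+ 2)%R by apply: wint_ge0; solve_ge0.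
case: (wint _ _) => [b| |]//; case: (wint _ _) => [a| |]// _ _ _.
by exists a, b.
Qed.

(** The coefficients may have either sign, whereas splitting at the origin is available for
    nonnegative integrands. Adding c = |p| + |q| to both makes them nonnegative, and the finite
    surplus is subtracted afterwards. *)
Lemma integral_sign_power alpha (p q a b : R) u : Cc_Rstar u ->
  wint alpha (fun x => u x ^+ 2)%R = a%:E -> wint alpha (fun x => u (- x) ^+ 2)%R = b%:E ->
  \int[mu]_x (u x ^+ 2 * (`|x| `^ (- alpha) * (if 0 < x then p else q)))%:E = (p * a + q * b)%:E.
Proof.
move=> uC aE bE; have mu_ := Cc_Rstar_measurable uC.
pose F (p q x : R) := (u x ^+ 2 * (`|x| `^ (- alpha) * (if 0 < x then p else q)))%R.
have iF p' q' : mu.-integrable setT (fun x => (F p' q' x)%:E).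
  by apply: Cc_Rstar_integrable => //; exact: locally_integrable_sign_power.
have pos p' q' : (0 <= p')%R -> (0 <= q')%R -> \int[mu]_x (F p' q' x)%:E = (p' * a + q' * b)%:E.
  move=> p0 q0; have mF : measurable_fun setT (fun x => (F p' q' x)%:E).
    by apply: measurable_int (iF p' q').
  have F0 x : (0 <= F p' q' x)%R.
    by rewrite /F; apply: mulr_ge0; [exact: sqr_ge0|apply: mulr_ge0; [exact: powR_ge0|case: ifPn]].
  rewrite integral_Rpos_reflect//.
  have -> : \int[mu]_(x in Rpos) (F p' q' x)%:E = (p' * a)%:E.
    rewrite EFinM -aE -wintZ//; last 2 first.
    - by solve_meas.
    - by solve_ge0.
    by apply: eq_integral_Rpos => x x0; rewrite /F x0 gtr0_norm// -EFinM; congr EFin; ring.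
  have -> : \int[mu]_(x in Rpos) (F p' q' (- x)%R)%:E = (q' * b)%:E.
    rewrite EFinM -bE -wintZ//; last 2 first.
    - have mN : measurable_fun setT (fun x : R => - x)%R by apply: measurable_funN; solve_meas.
      apply: measurable_funX; exact: (measurableT_comp mu_ mN).
    - by solve_ge0.
    apply: eq_integral_Rpos => x x0; rewrite /F oppr_gt0 ltNge (ltW x0)/= normrN gtr0_norm// -EFinM.
    by congr EFin; ring.
  by rewrite EFinD.
pose c := (`|p| + `|q|)%R.
have c0 : (0 <= c)%R by rewrite addr_ge0.
have pc : (0 <= p + c)%R by have := ler_norm (- p)%R; rewrite normrN /c; have := normr_ge0 q; lra.
have qc : (0 <= q + c)%R by have := ler_norm (- q)%R; rewrite normrN /c; have := normr_ge0 p; lra.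
have : \int[mu]_x (F p q x)%:E + \int[mu]_x (F c c x)%:E = \int[mu]_x (F (p + c)%R (q + c)%R x)%:E.
  rewrite -integralD//; apply: eq_integral => x _; rewrite -EFinD /F; congr EFin.
  by case: ifPn => _; ring.
rewrite (pos _ _ c0 c0) (pos _ _ pc qc).
case: (\int[mu]_x (F p q x)%:E) => [i| |]// [/(canRL (addrK _)) ->]; congr EFin.
by ring.
Qed.

End energy_identity.

(** * Criticality from vanishing remainders *)

Section criticality.
Context {R : realType}.
Notation mu := (@lebesgue_measure R).
Notation Rpos := (@Rpos R).
Local Open Scope ereal_scope.
Implicit Types (W w u : R -> R).

Lemma ge0_lty_EFin (x : \bar R) : 0 <= x -> x < +oo -> exists r : R, x = r%:E.
Proof. by case: x => [r| |]// _ _; exists r. Qed.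

(** The integral of u_n^2 (W - w) is nonnegative, nondecreasing in n and at most C/(n+1), so it is
    zero for every n. Hence almost everywhere all u_n^2 (W - w) vanish at once, and at each x != 0
    some u_n is nonzero. *)
Lemma ae_eq_of_vanishing_integrals W w (u : nat -> R -> R) (C : R) :
  locally_integrable (@Rstar R) W -> locally_integrable (@Rstar R) w ->
  (forall n, Cc_Rstar (u n)) ->
  (forall n m x, (n <= m)%N -> u n x ^+ 2 <= u m x ^+ 2)%R ->
  (forall x, x != 0 -> exists n, u n x != 0)%R ->
  {ae mu, forall x, (w x <= W x)%R} ->
  (forall n, \int[mu]_x (u n x ^+ 2 * W x)%:E <=
     \int[mu]_x (u n x ^+ 2 * w x)%:E + (C / n.+1%:R)%:E) ->
  {ae mu, forall x, W x = w x}.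
Proof.
move=> lW lw uC umono usupp wW bound.
have FF : Filter (almost_everywhere mu) := ae_filter_ringOfSetsType mu.
have iW n := Cc_Rstar_integrable lW (uC n).
have iw n := Cc_Rstar_integrable lw (uC n).
pose f n x := (u n x ^+ 2 * W x)%:E - (u n x ^+ 2 * w x)%:E.
have fE n x : f n x = (u n x ^+ 2 * (W x - w x))%:E by rewrite /f -EFinB mulrBr.
have if_ n : mu.-integrable setT (f n) by exact: integrableB.
have mf n : measurable_fun setT (f n) by exact: measurable_int (if_ n).
have maf n : measurable_fun setT (fun x => `|f n x|) by apply: (measurableT_comp _ (mf n)).
have b1 n : \int[mu]_x `|f n x| <= (C / n.+1%:R)%:E.
  have -> : \int[mu]_x `|f n x| = \int[mu]_x f n x.
    apply: ae_eq_integral; [exact: measurableT|exact: maf|exact: mf|].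
    apply: (@filterS _ _ FF _ _ _ wW) => x wWx _; rewrite fE abse_EFin ger0_norm//.
    by rewrite mulr_ge0 ?sqr_ge0// subr_ge0.
  rewrite /f integralB//.
  have := bound n.
  have := integrable_fin_num measurableT (iw n).
  case: (\int[mu]_x (u n x ^+ 2 * w x)%:E) => // i _.
  by move=> h; rewrite leeBlDl.
have f0 n : \int[mu]_x `|f n x| = 0.
  apply/eqP; rewrite eq_le; apply/andP; split; last exact: integral_ge0.
  apply/lee_addgt0Pr => e e0; rewrite add0e.
  (* An index beyond n with C/(m+1) <= e. *)
  pose m := maxn n (Num.truncn (C / e)).
  have nm : (n <= m)%N by exact: leq_maxl.
  apply: (@le_trans _ _ (\int[mu]_x `|f m x|)).
    apply: ge0_le_integral; [exact: measurableT|by []|exact: maf|exact: maf|].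
    move=> x _; rewrite !fE !abse_EFin !normrM lee_fin ler_wpM2r//.
    by rewrite -!normrM -!expr2 (ger0_norm (sqr_ge0 (u n x))) (ger0_norm (sqr_ge0 (u m x))) umono.
  apply: (le_trans (b1 m)); rewrite lee_fin ler_pdivrMr// -ler_pdivrMl// mulrC.
  apply: ltW; apply: lt_le_trans (truncnS_gt _) _.
  by rewrite ler_nat ltnS leq_maxr.
have z : {ae mu, forall x n, f n x = 0}.
  apply/ae_foralln => n.
  have h := (ae_eq_integral_abs mu measurableT (mf n)).1 (f0 n).
  by apply: (@filterS _ _ FF _ _ _ h) => x; exact.
have x0 : {ae mu, forall x : R, x != 0%R}.
  exists [set 0%R]; split; [exact: measurable_set1|exact: lebesgue_measure_set1|].
  by move=> x /= /negP/negPn/eqP.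
apply: (@filterS2 _ _ FF _ _ _ _ z x0) => x fx /usupp[n unx]; have := fx n; rewrite fE => -[] /eqP.
by rewrite mulf_eq0 sqrf_eq0 (negbTE unx)/= subr_eq0 => /eqP.
Qed.

(** The amplitude r on the negative half-line enters squared in its diagonal part and once in the
    mixed part. *)
Lemma truncated_remainder_le (alpha rho r : R) (k : R -> R -> \bar R) (L Lm Lpm : R) (n : nat) :
  homogeneous_kernel alpha k -> (alpha - 1 = rho + rho)%R -> (0 < r)%R ->
  \int[mu]_(t in `]0%R, 1%R[) ((t `^ rho * ln t ^+ 2)%:E * k 1%R t) = L%:E ->
  \int[mu]_(t in `]0%R, 1%R[) ((t `^ rho * ln t ^+ 2)%:E * k (-1)%R (- t)%R) = Lm%:E ->
  \int[mu]_(t in Rpos) ((t `^ rho * ln t ^+ 2)%:E * k 1%R (- t)%R) = Lpm%:E ->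
  hardy_remainder alpha rho r k (truncated_ground_state rho r n) <=
    (4 * (L + r ^+ 2 * Lm + r * Lpm) / n.+1%:R)%:E.
Proof.
move=> hk hrho r0 LE LmE LpmE.
have hmm := homogeneous_mm hk; have hpm := homogeneous_pm hk.
set u := truncated_ground_state rho r n.
have mu_ : measurable_fun setT u.
  exact: Cc_Rstar_measurable (Cc_truncated_ground_state rho r n).
have mN : measurable_fun setT (fun x : R => - x)%R by apply: measurable_funN; solve_meas.
have muN : measurable_fun setT (fun x : R => u (- x)%R) by exact: (measurableT_comp mu_ mN).
have uE x : (0 < x)%R -> (u x = x `^ rho * cutoff n x)%R.
  by move=> x0; rewrite /u /truncated_ground_state x0 gtr0_norm// mul1r.
have uNE x : (0 < x)%R -> (u (- x) = r * x `^ rho * cutoff n x)%R.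
  by move=> x0; rewrite /u /truncated_ground_state oppr_gt0 ltNge (ltW x0)/=;
    rewrite normrN gtr0_norm// cutoffN.
have uE1 x : (0 < x)%R -> (u x = 1 * x `^ rho * cutoff n x)%R by move=> x0; rewrite mul1r uE.
have b1 := diagonal_remainder_le hrho hk mu_ ler01 uE1.
have b2 := diagonal_remainder_le hrho hmm muN (ltW r0) uNE.
have b3 := offdiagonal_remainder_le hrho hpm r0 mu_ muN uE uNE.
have b := leeD (leeD b1 b2) b3.
apply: (le_trans b).
rewrite LE [X in (r ^+ 2)%:E * X](_ : _ = Lm%:E)// [X in r%:E * X](_ : _ = Lpm%:E)//.
rewrite -!(EFinM, EFinD) lee_fin le_eqVlt; apply/orP; left; apply/eqP.
by field; rewrite gt_eqF.
Qed.

End criticality.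

Theorem corollary3p10 (R : realType) (alpha r : R) (k : R -> R -> \bar R)
    (alpha_gt0 : 0 < alpha) (alpha_lt2 : alpha < 2) (r_gt0 : 0 < r)
    (kK : kernel_class alpha k) :
  (forall x : R, x != 0 -> M_weight alpha k r x \is a fin_num) /\
  critical_hardy_weight k (fun x : R => fine (M_weight alpha k r x)).
Proof.
have [mk k0 ksym khom [c c0 kc]] := kK.
have hk : homogeneous_kernel alpha k by split.
have hmm := homogeneous_mm hk; have hpm := homogeneous_pm hk.
have [_ mm0 _] := hmm; have [_ pm0 _] := hpm.
pose rho := (alpha - 1) / 2.
have hrho : alpha - 1 = rho + rho by rewrite /rho; lra.
have rho1 : -1 < rho by rewrite /rho; lra.
have rho2 : rho < alpha by rewrite /rho; lra.
have kc_pp (t : R) : 0 < t < 1 -> (k 1%R t <= (c * (1 - t) `^ (- alpha - 1))%:E)%E.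
  move=> /andP[t0 t1]; have := kc 1 t; rewrite gt_eqF// gtr0_norm ?subr_gt0//; exact.
have kc_mm (t : R) : 0 < t < 1 -> (kernel_mm k 1%R t <= (c * (1 - t) `^ (- alpha - 1))%:E)%E.
  move=> /andP[t0 t1]; have := kc (-1) (- t).
  by rewrite eqr_opp gt_eqF// opprK addrC distrC gtr0_norm ?subr_gt0//; exact.
have kc_pm (t : R) : 0 < t -> (kernel_pm k 1%R t <= (c * (1 + t) `^ (- alpha - 1))%:E)%E.
  move=> t0; have := kc 1 (- t); rewrite opprK gtr0_norm ?addr_gt0//; apply.
  by rewrite gt_eqF// (@lt_trans _ _ 0)// oppr_lt0.
have kc_mp (t : R) : 0 < t -> (k (-1)%R t <= (c * (1 + t) `^ (- alpha - 1))%:E)%E.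
  move=> t0; have := kc (-1) t; rewrite -opprD normrN gtr0_norm ?addr_gt0//; apply.
  by rewrite lt_eqF// (@lt_trans _ _ 0)// oppr_lt0.
have mkc (f g : R -> R) : measurable_fun setT f -> measurable_fun setT g ->
    measurable_fun setT (fun t => k (f t) (g t)) by move=> mf mg; exact: (measurable_fun_comp2 mk).
have mN : measurable_fun setT (fun x : R => - x)%R by apply: measurable_funN; solve_meas.
have m_pp : measurable_fun setT (fun t => k 1 t) by apply: mkc; solve_meas.
have m_mm : measurable_fun setT (fun t => kernel_mm k 1 t) by apply: mkc; solve_meas.
have m_pm : measurable_fun setT (fun t => kernel_pm k 1 t) by apply: mkc; solve_meas.
have m_mp : measurable_fun setT (fun t => k (-1) t) by apply: mkc; solve_meas.
have g0 (t : R) : 0 <= (1 - t `^ rho) * (1 - t `^ (alpha - 1 - rho)).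
  by rewrite hrho addrK -expr2 sqr_ge0.
have l0 (t : R) : 0 <= t `^ rho * ln t ^+ 2 by solve_ge0.
have pos (D : set R) (f : R -> R) (K : R -> \bar R) :
    (forall t, 0 <= f t) -> (forall t, 0 <= K t)%E ->
    (0 <= \int[leb]_(t in D) ((f t)%:E * K t))%E.
  by move=> f0 K0; apply: integral_ge0 => t _; rewrite mule_ge0// lee_fin.
have [g gE] : exists g, gamma_plus alpha k rho = g%:E.
  apply: ge0_lty_EFin; first exact: pos.
  exact: (@integral_01_kernel_gamma _ alpha c).
have [gm gmE] : exists g, gamma_minus alpha k rho = g%:E.
  apply: ge0_lty_EFin; first exact: pos.
  exact: (@integral_01_kernel_gamma _ alpha c).
(* The plain kernel integral is the case of exponent 0, admissible since -1 < 0 < alpha. *)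
have one (K : R -> \bar R) :
    (\int[leb]_(t in Rpos) K t = \int[leb]_(t in Rpos) ((t `^ 0)%:E * K t))%E.
  by apply: eq_integral => t _; rewrite powRr0 mul1e.
have [s sE] : exists s, (\int[leb]_(t in Rpos) k 1%R (- t)%R = s%:E)%E.
  apply: ge0_lty_EFin; first by apply: integral_ge0.
  by rewrite one; exact: (@integral_Rpos_kernel_powR _ alpha c).
have [sm smE] : exists s, (\int[leb]_(t in Rpos) k (-1)%R t = s%:E)%E.
  apply: ge0_lty_EFin; first by apply: integral_ge0.
  by rewrite one; exact: (@integral_Rpos_kernel_powR _ alpha c).
have [T TE] : exists s, (\int[leb]_(t in Rpos) ((t `^ rho)%:E * k 1%R (- t)%R) = s%:E)%E.
  apply: ge0_lty_EFin; first by apply: pos => // t; exact: powR_ge0.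
  exact: (@integral_Rpos_kernel_powR _ alpha c).
have [Tm TmE] : exists s, (\int[leb]_(t in Rpos) ((t `^ rho)%:E * k (-1)%R t) = s%:E)%E.
  apply: ge0_lty_EFin; first by apply: pos => // t; exact: powR_ge0.
  exact: (@integral_Rpos_kernel_powR _ alpha c).
have [L LE] : exists s,
    (\int[leb]_(t in `]0%R, 1%R[) ((t `^ rho * ln t ^+ 2)%:E * k 1%R t) = s%:E)%E.
  apply: ge0_lty_EFin; first exact: pos.
  exact: (@integral_01_kernel_ln _ alpha c).
have [Lm LmE] : exists s,
    (\int[leb]_(t in `]0%R, 1%R[) ((t `^ rho * ln t ^+ 2)%:E * k (-1)%R (- t)%R) = s%:E)%E.
  apply: ge0_lty_EFin; first exact: pos.
  exact: (@integral_01_kernel_ln _ alpha c).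
have [Lpm LpmE] : exists s,
    (\int[leb]_(t in Rpos) ((t `^ rho * ln t ^+ 2)%:E * k 1%R (- t)%R) = s%:E)%E.
  apply: ge0_lty_EFin; first exact: pos.
  exact: (@integral_Rpos_kernel_ln _ alpha c).
pose p := g + s - r * T; pose q := gm + sm - r^-1 * Tm.
have pE : C_plus alpha k r rho = p%:E by rewrite /C_plus gE -/Rpos sE TE.
have qE : C_minus alpha k r rho = q%:E by rewrite /C_minus gmE -/Rpos smE TmE.
have ME x : M_weight alpha k r x = (`|x| `^ (- alpha) * (if 0 < x then p else q))%:E.
  by rewrite /M_weight /m_weight -/rho pE qE EFinM; case: ifP.
split; first by move=> x _; rewrite ME.
have -> : (fun x => fine (M_weight alpha k r x)) =
    (fun x => `|x| `^ (- alpha) * (if 0 < x then p else q)).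
  by apply/funext => x; rewrite ME.
set w := (fun x => _ : R).
have lw : locally_integrable (@Rstar R) w by exact: locally_integrable_sign_power.
(* The ground state representation: the Hardy inequality is the nonnegativity of the remainder, and
   criticality its decay along the truncated ground states. *)
have E u : Cc_Rstar u -> energy k u =
    (hardy_remainder alpha rho r k u + \int[leb]_x (u x ^+ 2 * w x)%:E)%E.
  move=> uC; have [a [b [aE bE]]] := wint_Cc_fin alpha uC.
  rewrite (integral_sign_power p q uC aE bE).
  exact: (energy_identity hk ksym hrho r_gt0 (Cc_Rstar_measurable uC) gE gmE sE smE TE TmE aE bE).
split.
  by split => // u uC; rewrite E// leeDr// hardy_remainder_ge0.
move=> W [lW HW] wW.
apply: (@ae_eq_of_vanishing_integrals _ W w (truncated_ground_state rho r)
  (4 * (L + r ^+ 2 * Lm + r * Lpm))) => //.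
- by move=> n; exact: Cc_truncated_ground_state.
- move=> n m x nm; rewrite /truncated_ground_state !exprMn.
  apply: ler_wpM2l; first by rewrite -exprMn sqr_ge0.
  by rewrite lerXn2r ?nnegrE ?cutoff_ge0// cutoff_le.
- move=> x x0; have [n cn] := cutoff_gt0 x0; exists n.
  rewrite /truncated_ground_state !mulf_neq0// ?gt_eqF ?powR_gt0 ?normr_gt0//.
  by case: ifP; rewrite ?oner_neq0// gt_eqF.
move=> n; have uC := Cc_truncated_ground_state rho r n.
(* The inequality for W, tested on the truncated ground state, bounds its weighted integral by the
   energy, which exceeds that of w only by the remainder. *)
apply: (le_trans (HW _ uC)); rewrite (E _ uC) [leLHS]addeC. apply: leeD => //.
exact: truncated_remainder_le.
Qed.
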